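(* The problem 1-DC-3 (1-SP-AV control by deleting candidates in 3-peaked elections) is W[1]-hard with respect to the parameter $R$, the maximum number of deleted candidates.
   Context: A 1-SP-AV election consists of a finite set of candidates and a finite multiset of votes, each vote being a linear order over all candidates; each vote gives 1 point to its top-ranked candidate and 0 points to all others. The score of a candidate is its total number of points; a candidate is the unique winner if its score is strictly larger than that of every other candidate. A vote $\succ_v$ over a set $C$ is single-peaked with respect to a linear ordering $L$ of $C$ if for all $a,b,c\in C$ with $b$ between $a$ and $c$ in $L$, $c\succ_v b$ implies $b\succ_v a$. For a set $C'$ of candidates, $\pi_v(C')$ is the restriction of vote $\pi_v$ to $C'$ (preserving relative order), and for a multiset $\Pi$ of votes $\Pi(C')$ is obtained by restricting each vote. A vote $\pi_v$ is $k$-peaked with respect to $\mathcal{L}=(c_1,\dots,c_m)$ if $\mathcal{L}$ can be split into at most $k$ nonempty consecutive blocks $L_1,\dots$ such that for each block $L_t$, $\pi_v(\mathcal{C}(L_t))$ is single-peaked with respect to $L_t$, where $\mathcal{C}(L_t)$ is the set of candidates of $L_t$. Problem $r$-DC-$k$: Input: candidate set $\mathcal{C}\cup\{p\}$ with distinguished candidate $p$, a multiset $\Pi_{\mathcal{V}}$ of votes, a linear ordering $\mathcal{L}$ of $\mathcal{C}\cup\{p\}$ such that all votes are $k$-peaked with respect to $\mathcal{L}$, and an integer $0\le R\le|\mathcal{C}|$. Question: is there a set $C\subseteq\mathcal{C}$ with $|C|\le R$ such that $p$ is the unique winner of the $r$-SP-AV election with candidate set $(\mathcal{C}\cup\{p\})\setminus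 C$ and votes $\Pi_{\mathcal{V}}((\mathcal{C}\cup\{p\})\setminus C)$? *)

(* Defs.v *)
From mathcomp Require Import all_boot.
Set Implicit Arguments. Unset Strict Implicit. Unset Printing Implicit Defensive.

(*    Tape symbols are 'I_(nsym.+3): 0 = blank, 1 = input bit false,         *)
(*    2 = input bit true, the others are extra work symbols.                 *)
(*    The machine halts when the transition function returns None.          *)

Inductive move := MLeft | MRight | MStay.

Record TM := mkTM {
  tm_nst : nat;
  tm_nsym : nat;
  tm_start : 'I_tm_nst;
  tm_delta : 'I_tm_nst -> 'I_tm_nsym.+3 ->
             option ('I_tm_nst * 'I_tm_nsym.+3 * move)
}.

Record config (M : TM) := mkConfig {
  cf_state : 'I_(tm_nst M);
  cf_left : seq 'I_(tm_nsym M).+3;   (* cells left of the head, nearest first *)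
  cf_head : 'I_(tm_nsym M).+3;
  cf_right : seq 'I_(tm_nsym M).+3   (* cells right of the head, nearest first *)
}.

Definition blank {n : nat} : 'I_n.+3 := ord0.
Definition sym_of_bool {n : nat} (b : bool) : 'I_n.+3 :=
  if b then inord 2 else inord 1.

Definition do_move (M : TM) (q : 'I_(tm_nst M)) (l : seq 'I_(tm_nsym M).+3)
  (a : 'I_(tm_nsym M).+3) (r : seq 'I_(tm_nsym M).+3) (m : move) : config M :=
  match m with
  | MStay => mkConfig q l a r
  | MLeft => match l with
             | [::] => mkConfig q [::] blank (a :: r)
             | x :: l' => mkConfig q l' x (a :: r)
             end
  | MRight => match r with
              | [::] => mkConfig q (a :: l) blank [::]
              | x :: r' => mkConfig q (a :: l) x r'
              end
  end.

Definition tm_step (M : TM) (c : config M) : option (config M) :=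
  match tm_delta (cf_state c) (cf_head c) with
  | None => None
  | Some (q, a, m) => Some (do_move q (cf_left c) a (cf_right c) m)
  end.

Fixpoint tm_run (M : TM) (n : nat) (c : config M) : option (config M) :=
  match n with
  | 0 => Some c
  | n'.+1 => match tm_step c with
             | None => None
             | Some c' => tm_run n' c'
             end
  end.

Definition tm_init (M : TM) (w : seq bool) : config M :=
  match map sym_of_bool w with
  | [::] => mkConfig (tm_start M) [::] blank [::]
  | a :: r => mkConfig (tm_start M) [::] a r
  end.

Fixpoint read_output {n : nat} (s : seq 'I_n.+3) : option (seq bool) :=
  match s with
  | [::] => Some [::]
  | x :: s' =>
      if val x == 0 then Some [::]
      else if val x == 1 then omap (cons false) (read_output s')
      else if val x == 2 then omap (cons true) (read_output s')
      else None
  end.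

Definition cf_output (M : TM) (c : config M) : option (seq bool) :=
  read_output (cf_head c :: cf_right c).

Definition tm_run_out (M : TM) (w : seq bool) (t : nat) (out : seq bool) : Prop :=
  exists c, tm_run t (tm_init M w) = Some c /\ tm_step c = None /\
            cf_output c = Some out.

Definition tm_computes_nat (M : TM) (f : nat -> nat) : Prop :=
  forall k, exists t, tm_run_out M (nseq k false) t (nseq (f k) false).

Definition enc_nat (n : nat) : seq bool := rcons (nseq n false) true.
Definition enc_list (s : seq nat) : seq bool :=
  enc_nat (size s) ++ flatten (map enc_nat s).

(* 3. The Clique problem (parameter: k), the standard W[1]-complete problem. *)

Definition has_clique (n k : nat) (E : seq (nat * nat)) : Prop :=
  exists K : seq nat, [/\ uniq K, size K = k, all (fun x => x < n) K &
    forall x y, x \in K -> y \in K -> x != y -> ((x, y) \in E) || ((y, x) \in E)].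

Definition enc_clique (n k : nat) (E : seq (nat * nat)) : seq bool :=
  enc_nat n ++ enc_nat k ++ enc_nat (size E) ++
  flatten [seq enc_nat e.1 ++ enc_nat e.2 | e <- E].

(* 4. W[1]-hardness: an fpt-reduction from Clique (parameterized by k).      *)
(*    The reduction is a Turing machine running in time f(k) * |x|^c         *)
(*    (|x| + 1 to avoid 0^0 issues), f and g computable (by Turing machines), *)
(*    and the produced instance has parameter at most g(k).                  *)

Definition W1_hard {I : Type} (enc : I -> seq bool) (valid : I -> Prop)
  (yes : I -> Prop) (param : I -> nat) : Prop :=
  exists (M Mf Mg : TM) (f g : nat -> nat) (c : nat),
    [/\ tm_computes_nat Mf f, tm_computes_nat Mg g &
    forall (n k : nat) (E : seq (nat * nat)),
      exists (t : nat) (J : I),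
        [/\ t <= f k * (size (enc_clique n k E)).+1 ^ c,
            tm_run_out M (enc_clique n k E) t (enc J),
            valid J, param J <= g k &
            (has_clique n k E <-> yes J)]].

(*    Candidates are 0..m-1 (i.e. C u {p}), a vote is a list of all          *)
(*    candidates, most preferred first.                                       *)

Definition prefers (v : seq nat) (x y : nat) : bool := index x v < index y v.

Definition restrict (v : seq nat) (S : seq nat) : seq nat := [seq x <- v | x \in S].

Definition between (L : seq nat) (a b c : nat) : bool :=
  (index a L < index b L < index c L) || (index c L < index b L < index a L).

Definition single_peaked (v : seq nat) (L : seq nat) : Prop :=
  forall a b c, a \in L -> b \in L -> c \in L ->
    between L a b c -> prefers v c b -> prefers v b a.

Definition k_peaked (k : nat) (v : seq nat) (L : seq nat) : Prop :=
  exists bs : seq (seq nat),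
    [/\ flatten bs = L, all (fun b => b != [::]) bs, size bs <= k &
        forall b, b \in bs -> single_peaked (restrict v b) b].

Definition score1 (S : seq nat) (votes : seq (seq nat)) (x : nat) : nat :=
  count (fun v => ohead (restrict v S) == Some x) votes.

Definition unique_winner1 (S : seq nat) (votes : seq (seq nat)) (p : nat) : Prop :=
  p \in S /\ forall y, y \in S -> y != p -> score1 S votes y < score1 S votes p.

Record dc_inst := mkDC {
  dc_m : nat;
  dc_p : nat;
  dc_votes : seq (seq nat);
  dc_L : seq nat;
  dc_R : nat
}.

Definition dc_cands (I : dc_inst) : seq nat := iota 0 (dc_m I).
Definition dc_C (I : dc_inst) : seq nat := [seq x <- dc_cands I | x != dc_p I].

Definition is_vote (m : nat) (v : seq nat) : bool := perm_eq v (iota 0 m).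

Definition dc_valid (k : nat) (I : dc_inst) : Prop :=
  [/\ dc_p I < dc_m I, all (is_vote (dc_m I)) (dc_votes I),
      is_vote (dc_m I) (dc_L I),
      forall v, v \in dc_votes I -> k_peaked k v (dc_L I) &
      dc_R I <= size (dc_C I)].

Definition dc1_yes (I : dc_inst) : Prop :=
  exists D : seq nat,
    [/\ uniq D, {subset D <= dc_C I}, size D <= dc_R I &
        unique_winner1 [seq x <- dc_cands I | x \notin D] (dc_votes I) (dc_p I)].

Definition enc_dc (I : dc_inst) : seq bool :=
  enc_nat (dc_m I) ++ enc_nat (dc_p I) ++ enc_nat (dc_R I) ++ enc_list (dc_L I) ++
  enc_nat (size (dc_votes I)) ++ flatten (map enc_list (dc_votes I)).

(* Main.v *)
Require Import Defs.
From mathcomp Require Import all_boot.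
From mathcomp Require Import zify.
From Stdlib Require Import FunctionalExtensionality.
Set Implicit Arguments. Unset Strict Implicit. Unset Printing Implicit Defensive.

(* Clique reduces to 1-DC-3 with R = k.  The candidates are p = 0, the vertices 1..n, a
   block of k+1 rivals and a block of k+1 dummies; neither block can be deleted entirely.
   A vertex x contributes a vote x > p > ..., an edge xy a vote x > y > p > ..., a non-edge
   a vote headed by the dummies, and all remaining candidates follow in increasing order, so
   that each vote is increasing on at most three intervals.  Deleting D gives p one more
   point for every vertex and every edge inside D, hence at most k + C(k,2) points, with
   equality exactly when D is a clique of size k.  Votes for p and for the rivals are added
   so that p needs precisely this number of points to overtake the first remaining rival.

   The reduction is computed by a program on finitely many stacks of bits.  Such programs
   are compiled to flowcharts, and these to a Turing machine storing each stack on its own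
   track of the tape, with the bottom at the first input cell: the blank cell to the left of
   the input then marks the origin, and an instruction costs a walk to the top and back. *)

(** * Stack programs and their flowcharts *)

Definition store := nat -> seq bool.
Definition upd (s : store) (r : nat) (v : seq bool) : store :=
  fun z => if z == r then v else s z.
Definition pop (s : store) (r : nat) : store := upd s r (behead (s r)).

Definition branch {A} (l : seq bool) (e f t : A) : A :=
  if l is b :: _ then if b then t else f else e.

(* [If] and [For] pop [r] and branch on: empty, [false], [true]; [For] leaves when [r] is
   empty.  [While r c] runs [c] for each leading [false] of [r] and also pops the [true] that
   ends them, so it both iterates over a unary counter and reads one number of the input. *)
Inductive com :=
| Push of nat & bool
| Pop of nat
| Seq of com & com
| If of nat & com & com & com
| While of nat & com
| For of nat & com & com.

(** The time index counts flowchart instructions exactly, so that [exec_fsteps] can transfer it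
    unchanged. *)
Inductive exec : com -> store -> nat -> store -> Prop :=
| exec_push r b s : exec (Push r b) s 1 (upd s r (b :: s r))
| exec_pop r s : exec (Pop r) s 1 (pop s r)
| exec_seq c1 c2 s t1 s1 t2 s2 :
    exec c1 s t1 s1 -> exec c2 s1 t2 s2 -> exec (Seq c1 c2) s (t1 + t2) s2
| exec_if r c c0 c1 s t s' :
    exec (branch (s r) c c0 c1) (pop s r) t s' -> exec (If r c c0 c1) s t.+1 s'
| exec_while_stop r c s :
    ohead (s r) != Some false -> exec (While r c) s 1 (pop s r)
| exec_while_step r c s t1 s1 t2 s2 :
    ohead (s r) = Some false -> exec c (pop s r) t1 s1 ->
    exec (While r c) s1 t2 s2 -> exec (While r c) s (t1 + t2).+1 s2
| exec_for_stop r c0 c1 s : s r = [::] -> exec (For r c0 c1) s 1 (pop s r)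
| exec_for_step r c0 c1 b s t1 s1 t2 s2 :
    ohead (s r) = Some b -> exec (if b then c1 else c0) (pop s r) t1 s1 ->
    exec (For r c0 c1) s1 t2 s2 -> exec (For r c0 c1) s (t1 + t2).+1 s2.

(** The trailing numbers are successor addresses: one after a push, and after a pop one each for an
    empty stack, [false] and [true]. *)
Inductive instr :=
| IPush of nat & bool & nat
| IPop of nat & nat & nat & nat.

Definition ireg (i : instr) := match i with IPush r _ _ => r | IPop r _ _ _ => r end.

Fixpoint len (c : com) : nat :=
  match c with
  | Push _ _ | Pop _ => 1
  | Seq c1 c2 => len c1 + len c2
  | If _ c c0 c1 => (len c + len c0 + len c1).+1
  | While _ c => (len c).+1
  | For _ c0 c1 => (len c0 + len c1).+1
  end.

(* [comp c a k] is the code of [c] placed at address [a] and leaving to address [k]. *)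
Fixpoint comp (c : com) (a k : nat) : seq instr :=
  match c with
  | Push r b => [:: IPush r b k]
  | Pop r => [:: IPop r k k k]
  | Seq c1 c2 => comp c1 a (a + len c1) ++ comp c2 (a + len c1) k
  | If r c c0 c1 =>
      IPop r a.+1 (a.+1 + len c) (a.+1 + len c + len c0) ::
      comp c a.+1 k ++ comp c0 (a.+1 + len c) k ++ comp c1 (a.+1 + len c + len c0) k
  | While r c => IPop r k a.+1 k :: comp c a.+1 a
  | For r c0 c1 =>
      IPop r k a.+1 (a.+1 + len c0) :: comp c0 a.+1 a ++ comp c1 (a.+1 + len c0) a
  end.

Lemma size_comp c a k : size (comp c a k) = len c.
Proof.
elim: c a k => //= [c1 I1 c2 I2|r c I c0 I0 c1 I1|r c I|r c0 I0 c1 I1] a k;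
  by rewrite ?size_cat ?I ?I0 ?I1 ?I2 // !addnA.
Qed.

Definition fstep (prog : seq instr) (pc : nat) (s : store) : option (nat * store) :=
  match onth prog pc with
  | None => None
  | Some (IPush r b nx) => Some (nx, upd s r (b :: s r))
  | Some (IPop r pe p0 p1) => Some (branch (s r) pe p0 p1, pop s r)
  end.

Fixpoint fsteps prog t pc s pc' s' : Prop :=
  if t is t'.+1 then
    exists pc1 s1, fstep prog pc s = Some (pc1, s1) /\ fsteps prog t' pc1 s1 pc' s'
  else pc = pc' /\ s = s'.

Lemma fsteps_trans prog t1 t2 pc s pc1 s1 pc2 s2 :
  fsteps prog t1 pc s pc1 s1 -> fsteps prog t2 pc1 s1 pc2 s2 ->
  fsteps prog (t1 + t2) pc s pc2 s2.
Proof.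
elim: t1 pc s => [|t IH] pc s /= => [[-> ->]//|[pc' [s' [E H]]] H2].
by exists pc', s'; split=> //; apply: IH.
Qed.

Definition code_at (prog : seq instr) (a : nat) (code : seq instr) : Prop :=
  exists pre post, prog = pre ++ code ++ post /\ size pre = a.

Lemma code_at_cat prog a c1 c2 : code_at prog a (c1 ++ c2) ->
  code_at prog a c1 /\ code_at prog (a + size c1) c2.
Proof.
move=> [pre [post [-> <-]]]; split.
  by exists pre, (c2 ++ post); rewrite !catA.
by exists (pre ++ c1), post; rewrite !catA size_cat.
Qed.

Lemma code_at_cons prog a i c : code_at prog a (i :: c) ->
  onth prog a = Some i /\ code_at prog a.+1 c.
Proof.
move=> [pre [post [-> <-]]]; split.
  by rewrite onth_cat ltnn subnn.
by exists (rcons pre i), post; rewrite cat_rcons size_rcons.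
Qed.

(** A loop body is compiled with the address of the loop test as its exit, so after one round the
    induction hypothesis applies to the same code again. *)
Lemma exec_fsteps c s t s' : exec c s t s' -> forall prog a k,
  code_at prog a (comp c a k) -> fsteps prog t a s k s'.
Proof.
elim=> {c s t s'} /=.
- by move=> r b s prog a k /code_at_cons[E _]; exists k, (upd s r (b :: s r)); rewrite /fstep E.
- move=> r s prog a k /code_at_cons[E _]; exists k, (pop s r); rewrite /fstep E.
  by case: (s r) => [|[] l].
- move=> c1 c2 s t1 s1 t2 s2 _ I1 _ I2 prog a k /code_at_cat[H1]; rewrite size_comp => H2.
  exact: fsteps_trans (I1 _ _ _ H1) (I2 _ _ _ H2).
- move=> r c c0 c1 s t s' _ IH prog a k /code_at_cons[E] /code_at_cat[H].
  rewrite size_comp => /code_at_cat[H0]; rewrite size_comp => H1.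
  exists (branch (s r) a.+1 (a.+1 + len c) (a.+1 + len c + len c0)), (pop s r).
  rewrite /fstep E; split=> //.
  by case: (s r) IH => [|[] l] /= IH; apply: IH.
- move=> r c s E prog a k /code_at_cons[Ea _]; exists k, (pop s r); rewrite /fstep Ea.
  by move: E; case: (s r) => [|[] l].
- move=> r c s t1 s1 t2 s2 E _ I1 _ I2 prog a k H.
  have [Ea H1] := code_at_cons H; exists a.+1, (pop s r); split.
    by rewrite /fstep Ea; move: E; case: (s r) => [|[] l].
  exact: fsteps_trans (I1 _ _ _ H1) (I2 _ _ _ H).
- by move=> r c0 c1 s E prog a k /code_at_cons[Ea _]; exists k, (pop s r); rewrite /fstep Ea E.
- move=> r c0 c1 b s t1 s1 t2 s2 E _ I1 _ I2 prog a k H.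
  have [Ea /code_at_cat[H0]] := code_at_cons H; rewrite size_comp => H1.
  exists (if b then a.+1 + len c0 else a.+1), (pop s r); split.
    by rewrite /fstep Ea; move: E; case: (s r) => [|b' l] //= [->].
  by apply: fsteps_trans (I2 _ _ _ H); apply: I1; case: b {E}.
Qed.

Lemma fstep_size prog pc s pc' s' r :
  fstep prog pc s = Some (pc', s') -> size (s' r) <= (size (s r)).+1.
Proof.
rewrite /fstep; case: onth => [[q b nx|q pe p0 p1]|] // [_ <-]; rewrite /pop /upd.
  by case: eqP => [->|_] /=; lia.
by case: eqP => [->|_]; rewrite ?size_behead; lia.
Qed.

(** * Simulation of a flowchart by a one-tape Turing machine *)

Section Machine.

Variables (R : nat) (prog : seq instr).

(** Track [r] of a cell holds one bit of stack [r], or [None] above its top. *)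
Definition cell := {ffun 'I_R.+1 -> option bool}.
Definition raw (o : option bool) : cell := [ffun r => if r == ord0 then o else None].
Definition sym := 'I_(#|{: cell}|.+3).

(* A cell all of whose tracks but the zeroth are blank is written with the input alphabet. *)
Definition enc (x : cell) : sym :=
  if x == raw None then ord0
  else if x == raw (Some false) then inord 1
  else if x == raw (Some true) then inord 2
  else inord (index x (enum {: cell})).+3.

Definition dec (a : sym) : cell :=
  match nat_of_ord a with
  | 0 => raw None
  | 1 => raw (Some false)
  | 2 => raw (Some true)
  | n.+3 => nth (raw None) (enum {: cell}) n
  end.

Lemma encK : cancel enc dec.
Proof.
move=> x; rewrite /enc; case: eqP => [->|_]; first by rewrite /dec.
case: eqP => [->|_]; first by rewrite /dec inordK.
case: eqP => [->|_]; first by rewrite /dec inordK.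
have H : x \in enum {: cell} by rewrite mem_enum.
by rewrite /dec inordK ?nth_index // !ltnS cardE index_mem.
Qed.

Lemma raw_inj : injective raw.
Proof. by move=> o o' /ffunP/(_ ord0); rewrite !ffunE. Qed.

Lemma enc_raw o : enc (raw o) = if o is Some b then sym_of_bool b else blank.
Proof.
rewrite /enc !(inj_eq raw_inj) /sym_of_bool; by case: o => [[]|].
Qed.

(* A state is a program counter with a phase: [None] is walking right to the top of the
   stack of the current instruction, [Some None] reads the popped symbol, and
   [Some (Some r)] walks back left on track [r]. *)
Definition control := ('I_(size prog).+1 * option (option 'I_R.+1))%type.

(** All addresses past the code collapse to [size prog], the single halting address, which keeps the
    state set finite. *)
Definition at_pc (pc : nat) : 'I_(size prog).+1 := inord (minn pc (size prog)).

Lemma onth_at_pc pc : onth prog (at_pc pc) = onth prog pc.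
Proof.
rewrite /at_pc inordK ?ltnS ?geq_minr //; case: (leqP pc (size prog)) => // /ltnW H.
by rewrite !onth_default.
Qed.

Definition track (x : cell) (r : nat) := x (inord r).
Definition set_track (x : cell) (r : nat) (o : option bool) : cell :=
  [ffun z => if z == inord r then o else x z].

(** A push writes on the first blank cell of its track; a pop steps back from it to read the top. On
    an empty stack this step lands on cell 0, which is blank on every track: this is how emptiness
    is detected. *)
Definition trans (q : control) (a : sym) : option (control * sym * move) :=
  let x := dec a in
  match q.2 with
  | Some (Some r) =>
      Some (if x r is None then ((q.1, None), a, MRight) else (q, a, MLeft))
  | None =>
      match onth prog q.1 with
      | None => None
      | Some (IPush r b nx) =>
          Some (if track x r is None
                then ((at_pc nx, Some (Some (inord r))), enc (set_track x r (Some b)), MLeft)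
                else (q, a, MRight))
      | Some (IPop r _ _ _) =>
          Some (if track x r is None then ((q.1, Some None), a, MLeft) else (q, a, MRight))
      end
  | Some None =>
      if onth prog q.1 is Some (IPop r pe p0 p1) then
        Some (if track x r is Some b
              then ((at_pc (if b then p1 else p0), Some (Some (inord r))),
                    enc (set_track x r None), MLeft)
              else ((at_pc pe, None), a, MRight))
      else None
  end.

Definition machine : TM :=
  @mkTM #|{: control}| #|{: cell}| (enum_rank (at_pc 0, None))
    (fun q a => omap (fun z => (enum_rank z.1.1, z.1.2, z.2)) (trans (enum_val q) a)).

(* [T 0] is the cell left of the input, [T j.+1] the [j]-th input cell. *)
Definition holds (c : config machine) (q : control) (T : nat -> sym) (p : nat) : Prop :=
  [/\ cf_state c = enum_rank q,
      forall i, nth blank (cf_head c :: cf_right c) i = T (p + i) &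
      forall i, nth blank (cf_left c) i = if i < p then T (p - i.+1) else blank].

(** [holds] reads the lists with default [blank], so an exhausted list and explicit blank cells
    describe the same tape. The new tape is given pointwise for the same reason. *)
Lemma holds_step c q T p q' a m T' :
  holds c q T p -> trans q (T p) = Some (q', a, m) -> (m = MLeft -> 0 < p) ->
  T' p = a -> (forall z, z != p -> T' z = T z) ->
  exists c', tm_step c = Some c' /\
    holds c' q' T' (match m with MLeft => p.-1 | MRight => p.+1 | MStay => p end).
Proof.
case: c => st l h r [/= -> Hr Hl] Ht Hm Ta Tz.
have Eh : h = T p by rewrite -[p]addn0 -Hr.
rewrite /tm_step /= enum_rankK Eh Ht /=; eexists; split=> //.
have Hr' i : nth blank r i = T (p + i.+1) by rewrite -Hr.
case: m Hm {Ht} => Hm /=.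
- have p0 := Hm erefl; case: l Hl => [|x l] Hl; split=> //=.
  + case=> [|[|i]] /=; rewrite ?addn0.
    * by rewrite Tz; [have := Hl 0; rewrite p0 subn1 /= => <- | lia].
    * by rewrite (_ : p.-1 + 1 = p) //; lia.
    * by rewrite Hr' (_ : p.-1 + i.+2 = p + i.+1) ?Tz //; lia.
  + move=> i; rewrite nth_nil; case: ifP => // H; have /= := Hl i.+1.
    by rewrite (_ : i.+1 < p); [move=> ->; rewrite Tz; [congr T|]|]; lia.
  + case=> [|[|i]] /=; rewrite ?addn0.
    * by rewrite Tz; [have := Hl 0; rewrite p0 subn1 /= => <- | lia].
    * by rewrite (_ : p.-1 + 1 = p) //; lia.
    * by rewrite Hr' (_ : p.-1 + i.+2 = p + i.+1) ?Tz //; lia.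
  + move=> i; have /= -> := Hl i.+1; rewrite (_ : (i.+1 < p) = (i < p.-1)); last lia.
    by case: ifP => // H; rewrite Tz; [congr T|]; lia.
- have HL i : nth blank (a :: l) i = if i < p.+1 then T' (p.+1 - i.+1) else blank.
    case: i => [|i] /=; first by rewrite subn1.
    by rewrite Hl ltnS; case: ifP => // H; rewrite subSS Tz //; lia.
  case: r Hr Hr' => [|x r] Hr Hr'; split=> //= i.
  + by rewrite Tz; [have := Hr' i; rewrite nth_nil addSnnS => <-; case: i => [|[]] | lia].
  + by rewrite Tz; [rewrite addSnnS -Hr' | lia].
- split=> //=.
  + case=> [|i] /=; first by rewrite addn0.
    by rewrite Hr' Tz //; lia.
  + by move=> i; rewrite Hl; case: ifP => // H; rewrite Tz //; lia.
Qed.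

Definition reach t q T p q' T' p' : Prop := forall c, holds c q T p ->
  exists c', tm_run t c = Some c' /\ holds c' q' T' p'.

Lemma tm_run_add t1 t2 (c : config machine) c1 :
  tm_run t1 c = Some c1 -> tm_run (t1 + t2) c = tm_run t2 c1.
Proof.
elim: t1 c => [|t IH] c /=; first by case=> ->.
by case: tm_step => // c' /IH.
Qed.

Lemma reach_trans t1 t2 q T p q1 T1 p1 q2 T2 p2 :
  reach t1 q T p q1 T1 p1 -> reach t2 q1 T1 p1 q2 T2 p2 ->
  reach (t1 + t2) q T p q2 T2 p2.
Proof.
move=> H1 H2 c /H1[c1 [E1 /H2[c2 [E2 h2]]]]; exists c2; split=> //.
by rewrite (tm_run_add _ E1).
Qed.

Lemma reach_right q T p q' a T' : trans q (T p) = Some (q', a, MRight) ->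
  T' p = a -> (forall z, z != p -> T' z = T z) -> reach 1 q T p q' T' p.+1.
Proof.
move=> H Ta Tz c h; have [//|c' [E h']] := holds_step h H _ Ta Tz.
by exists c'; rewrite /= E.
Qed.

Lemma reach_left q T p q' a T' : trans q (T p.+1) = Some (q', a, MLeft) ->
  T' p.+1 = a -> (forall z, z != p.+1 -> T' z = T z) -> reach 1 q T p.+1 q' T' p.
Proof.
move=> H Ta Tz c h; have [//|c' [E h']] := holds_step h H _ Ta Tz.
by exists c'; rewrite /= E.
Qed.

Lemma reach_walk_right q T p j :
  (forall i, i < j -> trans q (T (p + i)) = Some (q, T (p + i), MRight)) ->
  reach j q T p q T (p + j).
Proof.
elim: j => [|j IH] H; first by rewrite addn0 => c h; exists c.
rewrite -addn1 addnA; apply: reach_trans (IH _) _ => [i ij|]; first by apply: H; lia.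
by rewrite addn1; apply: reach_right (H _ _) _ _.
Qed.

Lemma reach_walk_left q T j :
  (forall i, 0 < i <= j -> trans q (T i) = Some (q, T i, MLeft)) ->
  reach j q T j q T 0.
Proof.
elim: j => [|j IH] H; first by move=> c h; exists c.
rewrite -add1n; apply: reach_trans (IH _); last by move=> i ij; apply: H; lia.
by apply: reach_left (H _ _) _ _ => //; lia.
Qed.

Definition stack_cell (s : store) (j : nat) : cell := [ffun r : 'I_R.+1 => onth (rev (s r)) j].
Definition tape (s : store) (p : nat) : sym :=
  enc (if p is j.+1 then stack_cell s j else [ffun=> None]).

Lemma track_stack s j r : r <= R -> track (stack_cell s j) r = onth (rev (s r)) j.
Proof. by move=> rR; rewrite /track ffunE inordK. Qed.

(** Cells 1 to [j] carry bits on track [r], so the walk left first stops at the blank origin and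
    then steps to cell 1. *)
Lemma reach_back (T : nat -> sym) s r j pc : r <= R ->
  T =1 tape s -> j <= size (s r) ->
  reach (j + 1) (at_pc pc, Some (Some (inord r))) T j (at_pc pc, None) T 1.
Proof.
move=> rR ET jr; apply: reach_trans (reach_walk_left _) _.
  case=> // i /= ij; rewrite /trans /= ET /= encK -/(track _ _) track_stack //.
  have := onthTE (rev (s r)) i; rewrite size_rev (leq_trans ij jr).
  by case: onth => //.
by apply: reach_right => //; rewrite /trans /= ET /= encK ffunE.
Qed.

Lemma inord_eq (r z : nat) : r <= R -> z <= R ->
  ((inord z : 'I_R.+1) == inord r) = (z == r).
Proof. by move=> rR zR; rewrite -val_eqE /= !inordK. Qed.

Lemma stack_cell_upd s r v j : r <= R ->
  stack_cell (upd s r v) j = set_track (stack_cell s j) r (onth (rev v) j).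
Proof.
move=> rR; apply/ffunP=> z; rewrite !ffunE /upd -[z]inord_val inord_eq ?inordK // -1?ltnS //.
by case: eqP => // ->.
Qed.

Lemma set_track_id x r : set_track x r (track x r) = x.
Proof. by apply/ffunP=> z; rewrite !ffunE; case: eqP => [->|]. Qed.

Lemma tape_upd s r v z : r <= R -> onth (rev v) z = onth (rev (s r)) z ->
  tape (upd s r v) z.+1 = tape s z.+1.
Proof.
move=> rR E; congr enc; rewrite stack_cell_upd // E -track_stack //.
exact: set_track_id.
Qed.

Definition regs_ok := all (fun i => ireg i <= R) prog.

Lemma reach_to_top (q : control) T s r i : q.2 = None -> T =1 tape s -> r <= R ->
  onth prog q.1 = Some i -> ireg i = r ->
  reach (size (s r)) q T 1 q T (1 + size (s r)).
Proof.
case: q => pc ph /= -> ET rR Ei Er; apply: reach_walk_right => j jr.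
rewrite /trans /= Ei ET /= encK.
have := onthTE (rev (s r)) j; rewrite size_rev jr -(track_stack s j rR) -Er.
by case: i {Ei} Er => /= [r' b nx|r' pe p0 p1] Er; case: track.
Qed.

(** Between instructions the head rests on cell 1. An instruction walks up one stack, spends at most
    two steps at its top, and returns through the origin. *)
Lemma fstep_reach pc s pc' s' N : regs_ok -> fstep prog pc s = Some (pc', s') ->
  (forall r, size (s r) <= N) ->
  exists2 t, t <= 2 * N + 3 &
    reach t (at_pc pc, None) (tape s) 1 (at_pc pc', None) (tape s') 1.
Proof.
rewrite /fstep => ok; case Ei: (onth prog pc) => [i|] // E sN.
have iR : ireg i <= R.
  have <- := @onth_nth _ i _ _ _ Ei.
  by apply: (all_nthP i ok pc); rewrite -onthTE Ei.
case: i Ei iR E => [r b nx|r pe p0 p1] Ei /= rR [<- <-]; have rN := sN r.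
- have F : onth prog ((at_pc pc, None) : control).1 = Some (IPush r b nx).
    by rewrite onth_at_pc.
  exists (size (s r) + (1 + (size (s r) + 1))); first lia.
  apply: reach_trans (@reach_to_top (at_pc pc, None) (tape s) s r _ erefl (frefl _) rR F erefl) _.
  apply: (reach_trans _ (@reach_back _ _ r _ _ rR (frefl _) _)); last by rewrite /upd eqxx /=.
  apply: (@reach_left _ _ _ _ (enc (set_track (stack_cell s (size (s r))) r (Some b)))).
  + rewrite /trans /= onth_at_pc Ei encK track_stack // onth_default ?size_rev //.
  + rewrite /tape stack_cell_upd // rev_cons -cats1 onth_cat size_rev ltnn subnn //.
  + case=> // z zr; apply: tape_upd => //; rewrite rev_cons -cats1 onth_cat size_rev.
    case: ltnP => // h; rewrite (onth_default (s := rev _)) ?size_rev //.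
    by rewrite onth_default //= subn_gt0; lia.
- have F : onth prog ((at_pc pc, None) : control).1 = Some (IPop r pe p0 p1).
    by rewrite onth_at_pc.
  case Es: (s r) => [|b l] /=.
  + exists (size (s r) + (1 + 1)); first lia.
    apply: reach_trans (@reach_to_top (at_pc pc, None) (tape s) s r _ erefl (frefl _) rR F erefl) _.
    have Et : tape (pop s r) =1 tape s.
      by case=> // z; rewrite /pop Es; apply: tape_upd => //; rewrite Es.
    rewrite Es; apply: (@reach_trans _ _ _ _ _ (at_pc pc, Some None) (tape s) 0).
      by apply: reach_left => //; rewrite /trans /= onth_at_pc Ei encK track_stack // Es.
    apply: (@reach_right _ _ _ _ (tape s 0)) => [||z _]; last exact: Et.
      by rewrite /trans /= onth_at_pc Ei encK /track ffunE.
    exact: Et.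
  + exists (size (s r) + (1 + (1 + (size l + 1)))); first by rewrite Es /= in rN *; lia.
    apply: reach_trans (@reach_to_top (at_pc pc, None) (tape s) s r _ erefl (frefl _) rR F erefl) _.
    apply: (@reach_trans _ _ _ _ _ (at_pc pc, Some None) (tape s) (size (s r))).
      by apply: reach_left => //;
        rewrite /trans /= onth_at_pc Ei encK track_stack // onth_default ?size_rev.
    rewrite Es /=.
    apply: (reach_trans _ (@reach_back _ _ r _ _ rR (frefl _) _));
      last by rewrite /pop /upd eqxx Es /=.
    apply: (@reach_left _ _ _ _ (enc (set_track (stack_cell s (size l)) r None))).
    * rewrite /trans /= onth_at_pc Ei encK track_stack // Es rev_cons -cats1.
      rewrite onth_cat size_rev ltnn subnn /=.
      by case: b {Es}.
    * by rewrite /tape /pop stack_cell_upd // Es onth_default ?size_rev.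
    * case=> // z zr; apply: tape_upd => //; rewrite Es /= rev_cons -cats1 onth_cat size_rev.
      case: ltnP => // h; rewrite !onth_default ?size_rev //= subn_gt0; lia.
Qed.

(** A stack grows by at most one bit per instruction, so height plus remaining time never exceeds
    [N] during the run. *)
Lemma fsteps_reach t pc s pc' s' N : regs_ok -> fsteps prog t pc s pc' s' ->
  (forall r, size (s r) + t <= N) ->
  exists2 t', t' <= t * (2 * N + 3) &
    reach t' (at_pc pc, None) (tape s) 1 (at_pc pc', None) (tape s') 1.
Proof.
move=> ok; elim: t pc s => [|t IH] pc s /=.
  by move=> [<- <-] _; exists 0 => // c h; exists c.
move=> [pc1 [s1 [E H]]] sN.
have [r|t1 l1 r1] := fstep_reach (N := N) ok E; first by have := sN r; lia.
have [r|t2 l2 r2] := IH _ _ H; first by have := sN r; have := fstep_size r E; lia.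
by exists (t1 + t2); [lia | apply: reach_trans r1 r2].
Qed.

Lemma read_output_sym (l : seq sym) out :
  (forall j, nth blank l j = if onth out j is Some b then sym_of_bool b else blank) ->
  read_output l = Some out.
Proof.
elim: l out => [|a l IH] [|b out] H //=.
- by have /(congr1 val) := H 0; case: b {H}; rewrite /= inordK.
- by have /= -> := H 0.
- have /= -> := H 0; have -> := IH out (fun j => H j.+1).
  by case: b {H}; rewrite /sym_of_bool inordK.
Qed.

End Machine.

(** The first input cell is the bottom of stack 0, hence the reversal. *)
Definition input_store (w : seq bool) : store := upd (fun=> [::]) 0 (rev w).

(** The exit address is the first one past the code, where the flowchart halts. *)
Definition program (c : com) := comp c 0 (len c).

(** The other stacks must end empty: only then are the final cells blank outside the zeroth track,
    hence written in the input alphabet and readable as output. *)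
Theorem machine_run R c w s T out : regs_ok R (program c) ->
  exec c (input_store w) T s -> s 0 = rev out -> (forall r, 0 < r <= R -> s r = [::]) ->
  exists2 t, t <= T * (2 * (size w + T) + 3) & tm_run_out (machine R (program c)) w t out.
Proof.
move=> ok /exec_fsteps H s0 sr; set M := machine _ _.
have [|r|t tT Hr] := fsteps_reach (N := size w + T) ok (H (program c) 0 (len c) _).
- by exists [::], [::]; rewrite cats0.
- by rewrite /input_store /upd; case: eqP; rewrite ?size_rev //=; lia.
have [|c' [Ec [Eq Et _]]] := Hr (tm_init M w).
  have E j : tape R (input_store w) j.+1 = if onth w j is Some b then sym_of_bool b else blank.
    rewrite -enc_raw; congr enc; apply/ffunP=> r; rewrite !ffunE /input_store /upd.
    by rewrite -(val_eqE r ord0) /=; case: (_ == _); rewrite ?revK ?onth0n.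
  split.
  - by rewrite /tm_init; case: (w).
  - move=> i; rewrite -[RHS]/(tape _ _ i.+1) E.
    have -> : cf_head (tm_init M w) :: cf_right (tm_init M w) =
              if w is [::] then [:: blank] else map sym_of_bool w by case: (w).
    case: (w) => [|b l]; first by case: i => [|[]].
    rewrite -(odflt_onth _ (map _ _)) onth_map; by case: onth.
  - move=> i; rewrite (_ : cf_left _ = [::]) ?nth_nil; last by rewrite /tm_init; case: (w).
    case: ifP => // i1; rewrite (_ : 1 - i.+1 = 0); last lia.
    have -> : blank = enc (raw R None) by rewrite enc_raw.
    by congr enc; apply/ffunP=> r; rewrite !ffunE; case: eqP.
exists t => //; exists c'; split=> //; split.
  rewrite /tm_step Eq /= enum_rankK /trans /= onth_at_pc onth_default //.
  by rewrite /program size_comp.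
apply: read_output_sym => j; rewrite Et -enc_raw add1n; congr enc.
apply/ffunP=> r; rewrite !ffunE -(val_eqE r ord0) /=.
case: eqP => [->|/eqP r0]; first by rewrite s0 revK.
by rewrite sr ?onth0n // lt0n; apply/andP; split=> //; rewrite -ltnS.
Qed.

(** * Stack programs of polynomial cost *)

(* A program all of whose loops run at most [N] times takes at most [N ^ expo c] steps: for
   [N >= 2] every additive or multiplicative constant is absorbed by one more factor [N]. *)
Fixpoint expo (c : com) : nat :=
  match c with
  | Push _ _ | Pop _ => 0
  | Seq c1 c2 => (maxn (expo c1) (expo c2)).+1
  | If _ c c0 c1 => (maxn (expo c) (maxn (expo c0) (expo c1))).+1
  | While _ c => (expo c).+3
  | For _ c0 c1 => (maxn (expo c0) (expo c1)).+3
  end.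

Definition unary (n : nat) : seq bool := nseq n false.
Arguments unary : simpl never.

Lemma unaryS n : unary n.+1 = false :: unary n. Proof. by []. Qed.

Ltac lookup :=
  rewrite /pop /upd;
  repeat match goal with
  | |- context [?x == ?x] => rewrite (eqxx x)
  | H : is_true (?x != ?y) |- context [?x == ?y] => rewrite (negPf H)
  | H : is_true (?x != ?y) |- context [?y == ?x] => rewrite (eq_sym y x) (negPf H)
  | |- context [?x == ?y] => case: (eqVneq x y) => ?; [subst x|]
  end;
  try done; try congruence.

Ltac store_eq := apply: functional_extensionality => ?; lookup.

Lemma upd_id s r v : s r = v -> upd s r v = s.
Proof. by move=> <-; store_eq. Qed.

Lemma upd_upd s r v v' : upd (upd s r v) r v' = upd s r v'.
Proof. by store_eq. Qed.

(** With the stacks listed explicitly, lookups and updates at numerals reduce by computation. *)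
Definition st (l : seq (seq bool)) : store := fun z => nth [::] l z.

Lemma st_upd l r v : upd (st l) r v = st (set_nth [::] l r v).
Proof. by apply: functional_extensionality => z; rewrite /upd /st nth_set_nth. Qed.

Section Runs.

Variable N : nat.
Hypothesis N2 : 1 < N.

Definition runs (c : com) (s s' : store) : Prop := exists2 t, t <= N ^ expo c & exec c s t s'.

Let pow_gt0 e : 0 < N ^ e. Proof. by rewrite expn_gt0; lia. Qed.

Let powS e : 2 * N ^ e <= N ^ e.+1.
Proof. by rewrite expnS leq_mul2r N2 orbT. Qed.

Let pow_mono e f : e <= f -> N ^ e <= N ^ f.
Proof. by move=> ef; rewrite leq_exp2l. Qed.

Lemma runs_push r b s : runs (Push r b) s (upd s r (b :: s r)).
Proof. by exists 1 => //; constructor. Qed.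

Lemma runs_inc r n s : s r = unary n -> runs (Push r false) s (upd s r (unary n.+1)).
Proof. by move=> E; have := runs_push r false s; rewrite E. Qed.

Lemma runs_pop r s : runs (Pop r) s (pop s r).
Proof. by exists 1 => //; constructor. Qed.

Lemma runs_seq c1 c2 s s1 s2 : runs c1 s s1 -> runs c2 s1 s2 -> runs (Seq c1 c2) s s2.
Proof.
move=> [t1 l1 h1] [t2 l2 h2]; exists (t1 + t2); last exact: exec_seq h1 h2.
apply: leq_trans (powS _); rewrite mul2n -addnn.
apply: leq_add; [apply: leq_trans l1 _|apply: leq_trans l2 _]; apply: pow_mono;
  by rewrite leq_max leqnn ?orbT.
Qed.

Lemma runs_if r c c0 c1 s s' :
  runs (branch (s r) c c0 c1) (pop s r) s' -> runs (If r c c0 c1) s s'.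
Proof.
move=> [t tl H]; exists t.+1; last exact: exec_if.
apply: leq_trans (powS _); rewrite mul2n -addnn -addn1; apply: leq_add => //.
by apply: leq_trans tl _; apply: pow_mono; case: (s r) => [|[] ?]; rewrite !leq_max leqnn ?orbT.
Qed.

(** One round costs N^e + 1 <= N^(e+1), so [N] rounds cost at most N^(e+2); the last factor absorbs
    the final test. *)
Let loop_bound j e t : j <= N -> t <= j * (N ^ e).+1 + 1 -> t <= N ^ e.+3.
Proof.
move=> jN tl; apply: leq_trans (powS _); rewrite mul2n -addnn.
apply: leq_trans tl _; apply: leq_add => //.
rewrite expnS leq_mul //; apply: leq_trans (powS _); rewrite mul2n -addnn -addn1.
exact: leq_add.
Qed.

(** [F i] is the store at the loop test after [i] rounds; naming it replaces an induction at each
    use. *)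
Lemma runs_while r c j (F : nat -> store) : j <= N ->
  (forall i, i < j -> ohead (F i r) = Some false) -> ohead (F j r) != Some false ->
  (forall i, i < j -> runs c (pop (F i) r) (F i.+1)) ->
  runs (While r c) (F 0) (pop (F j) r).
Proof.
move=> jN Hf Hs Hc.
suff [t tl H] : exists2 t, t <= j * (N ^ expo c).+1 + 1 & exec (While r c) (F 0) t (pop (F j) r).
  by exists t => //; apply: loop_bound tl.
elim: j F {jN} Hf Hs Hc => [|j IH] F Hf Hs Hc.
  by exists 1 => //; apply: exec_while_stop.
have [t1 l1 h1] := Hc 0 isT.
have [t2 l2 h2] := IH (fun i => F i.+1) (fun i ij => Hf i.+1 ij) Hs (fun i ij => Hc i.+1 ij).
exists (t1 + t2).+1; first lia.
by apply: exec_while_step h1 h2; apply: Hf.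
Qed.

Lemma runs_count r c j (F : nat -> store) : j <= N ->
  (forall i, i <= j -> F i r = unary (j - i)) ->
  (forall i, i < j -> runs c (upd (F i) r (unary (j - i.+1))) (F i.+1)) ->
  runs (While r c) (F 0) (F j).
Proof.
move=> jN Hr Hc.
have -> : F j = pop (F j) r by rewrite /pop upd_id // Hr // subnn.
have Hi i : i < j -> F i r = false :: unary (j - i.+1).
  move=> ij; by rewrite Hr ?(ltnW ij) // -unaryS subnSK.
apply: runs_while => // [i ij||i ij]; first by rewrite Hi.
  by rewrite Hr // subnn.
by rewrite /pop Hi //; apply: Hc.
Qed.

Lemma runs_for r c0 c1 (l : seq bool) (F : nat -> store) : size l <= N ->
  (forall i, i <= size l -> F i r = drop i l) ->
  (forall i, i < size l ->
     runs (if nth false l i then c1 else c0) (upd (F i) r (drop i.+1 l)) (F i.+1)) ->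
  runs (For r c0 c1) (F 0) (F (size l)).
Proof.
move=> lN Hr Hc; set e := maxn (expo c0) (expo c1).
suff [t tl H] : exists2 t, t <= size l * (N ^ e).+1 + 1 & exec (For r c0 c1) (F 0) t (F (size l)).
  by exists t => //; apply: loop_bound tl.
elim: l F {lN} Hr Hc => [|b l IH] F Hr Hc.
  exists 1 => //; have {2}-> : F (size [::]) = pop (F 0) r by rewrite /pop upd_id // (Hr 0).
  by apply: exec_for_stop; rewrite Hr.
have := Hc 0 isT; rewrite /= drop0 => -[t1 l1 h1].
have [t2 l2 h2] := IH (fun i => F i.+1) (fun i ij => Hr i.+1 ij) (fun i ij => Hc i.+1 ij).
exists (t1 + t2).+1; last first.
  by apply: exec_for_step h2; [rewrite (Hr 0)|rewrite /pop (Hr 0)].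
have : N ^ expo (if b then c1 else c0) <= N ^ e.
  apply: pow_mono;
  by rewrite /e leq_max; case: b {Hr Hc h1 l1}; rewrite leqnn ?orbT.
by rewrite /=; lia.
Qed.

(** The first loop empties [r] into both [c] and the scratch stack [t], the second restores [r] from
    [t], so counters survive being read. *)
Definition Add c r t :=
  Seq (While r (Seq (Push c false) (Push t false))) (While t (Push r false)).

Lemma runs_add c r t s v : s r = unary v -> s t = [::] -> v <= N ->
  c != r -> c != t -> r != t -> runs (Add c r t) s (upd s c (unary v ++ s c)).
Proof.
move=> sr s0 vN cr ct rt.
pose F i := upd (upd (upd s r (unary (v - i))) c (unary i ++ s c)) t (unary i).
have -> : s = F 0 by rewrite /F subn0 !upd_id.
have -> : upd (F 0) c (unary v ++ F 0 c) = upd (upd s c (unary v ++ s c)) t [::].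
  by rewrite /F; store_eq; rewrite subn0.
apply: (@runs_seq _ _ _ (F v)).
  apply: (runs_count vN) => i iv; first by rewrite /F /upd eqxx (negPf rt) eq_sym (negPf cr).
  set s1 := upd (F i) r _.
  have -> : F i.+1 = upd (upd s1 c (false :: s1 c)) t (unary i.+1) by rewrite /s1 /F; store_eq.
  by apply: runs_seq (runs_push _ _ _) (runs_inc _); rewrite /s1 /F; lookup.
pose G i := upd (upd (upd s r (unary i)) c (unary v ++ s c)) t (unary (v - i)).
have -> : F v = G 0 by rewrite /F /G subnn subn0.
have -> : upd (upd s c (unary v ++ s c)) t [::] = G v by rewrite /G subnn -sr; store_eq.
apply: (runs_count vN) => i iv; first by rewrite /G /upd eqxx.
have -> : G i.+1 = upd (upd (G i) t (unary (v - i.+1))) r (unary i.+1) by rewrite /G; store_eq.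
by apply: runs_inc; rewrite /G /upd eqxx (negPf rt) eq_sym (negPf cr).
Qed.

Definition nums (a l : nat) := flatten (map enc_nat (iota a l)).

Lemma nums_S a l : nums a l.+1 = nums a l ++ enc_nat (a + l).
Proof. by rewrite /nums -addn1 iotaD map_cat flatten_cat /= cats0. Qed.

Lemma catrev_enc_nat v l : catrev (enc_nat v) l = true :: unary v ++ l.
Proof. by rewrite /enc_nat -cats1 catrev_catl /= catrevE rev_nseq. Qed.

(** The bits are pushed in order, so the code of the number is read from the bottom upwards and its
    closing [true] is on top. *)
Definition Write o c t := Seq (Add o c t) (Push o true).

Lemma runs_write o c t s v : s c = unary v -> s t = [::] -> v <= N ->
  o != c -> o != t -> c != t -> runs (Write o c t) s (upd s o (catrev (enc_nat v) (s o))).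
Proof.
move=> sc s0 vN oc ot ct; apply: runs_seq (runs_add sc s0 vN oc ot ct) _.
set s1 := upd _ _ _; have -> : upd s o (catrev (enc_nat v) (s o)) = upd s1 o (true :: s1 o).
  by rewrite /s1 catrev_enc_nat; store_eq.
exact: runs_push.
Qed.

Lemma runs_addn c r t s a v : s r = unary v -> s c = unary a -> s t = [::] -> v <= N ->
  c != r -> c != t -> r != t -> runs (Add c r t) s (upd s c (unary (v + a))).
Proof. by move=> sr sc *; rewrite [unary _]nseqD -/(unary v) -/(unary a) -sc; apply: runs_add. Qed.

(** The counter [c] is left just past the printed range, so that consecutive ranges can be chained;
    [t'] serves to restore the length [r]. *)
Definition WriteRange o c r t t' :=
  Seq (While r (Seq (Write o c t) (Seq (Push c false) (Push t' false))))
      (While t' (Push r false)).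

Lemma runs_range o c r t t' s a v : s c = unary a -> s r = unary v -> s t = [::] -> s t' = [::] ->
  a + v <= N -> uniq [:: o; c; r; t; t'] ->
  runs (WriteRange o c r t t') s (upd (upd s o (catrev (nums a v) (s o))) c (unary (a + v))).
Proof.
move=> sc sr s0 s0' avN; rewrite /= !inE !negb_or -!andbA.
case/and5P => oc or ot ot' /and5P[cr ct ct' rt /andP[rt' /andP[tt' _]]].
have vN : v <= N by lia.
pose F i := upd (upd (upd (upd s r (unary (v - i))) c (unary (a + i)))
                     o (catrev (nums a i) (s o))) t' (unary i).
have {1}-> : s = F 0 by rewrite /F subn0 addn0 !upd_id.
apply: (@runs_seq _ _ _ (F v)).
  apply: (runs_count vN) => i iv; first by rewrite /F; lookup.
  set s1 := upd (F i) r _.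
  have -> : F i.+1 =
      upd (upd (upd s1 o (catrev (enc_nat (a + i)) (s1 o))) c (unary (a + i).+1)) t' (unary i.+1).
    by rewrite /s1 /F nums_S catrev_catl addnS; store_eq.
  apply: (@runs_seq _ _ _ (upd s1 o (catrev (enc_nat (a + i)) (s1 o)))).
    by apply: runs_write => //; rewrite /s1 /F; [lookup|lookup|lia].
  by apply: runs_seq (runs_inc _) (runs_inc _); rewrite /s1 /F; lookup.
pose G i := upd (upd (upd (upd s r (unary i)) c (unary (a + v))) o (catrev (nums a v) (s o))) t' (unary (v - i)).
have -> : F v = G 0 by rewrite /F /G subnn subn0.
have -> : upd (upd s o (catrev (nums a v) (s o))) c (unary (a + v)) = G v.
  by rewrite /G subnn; store_eq.
apply: (runs_count vN) => i iv; first by rewrite /G; lookup.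
have -> : G i.+1 = upd (upd (G i) t' (unary (v - i.+1))) r (unary i.+1) by rewrite /G; store_eq.
by apply: runs_inc; rewrite /G; lookup.
Qed.

(** Popping an always empty stack is the no-operation of the language. *)
Lemma runs_skip z s : s z = [::] -> runs (Pop z) s s.
Proof. by move=> sz; have := runs_pop z s; rewrite /pop upd_id // sz. Qed.

Definition Clear z r := While r (Pop z).

Lemma runs_clear z r s v : s r = unary v -> s z = [::] -> v <= N -> z != r ->
  runs (Clear z r) s (upd s r (unary 0)).
Proof.
move=> sr sz vN zr; pose F i := upd s r (unary (v - i)).
have -> : upd s r (unary 0) = F v by rewrite /F subnn.
have {1}-> : s = F 0 by rewrite /F subn0 upd_id.
apply: (runs_count vN) => i iv; first by rewrite /F; lookup.
by rewrite /F upd_upd; apply: runs_skip; lookup.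
Qed.

(* Adds |a - p| to [d] and empties [a]. *)
Definition Dist z a p d t :=
  Seq (While p (Seq (Push t false) (If a (Push d false) (Pop z) (Pop z))))
 (Seq (While a (Push d false)) (While t (Push p false))).

Lemma runs_dist z a p d t s x y e : s a = unary x -> s p = unary y -> s d = unary e ->
  s t = [::] -> s z = [::] -> x <= N -> y <= N -> uniq [:: z; a; p; d; t] ->
  runs (Dist z a p d t) s (upd (upd s a [::]) d (unary (e + (y - x) + (x - y)))).
Proof.
move=> sa sp sd st0 sz xN yN; rewrite /= !inE !negb_or -!andbA.
case/and5P => za zp zd zt /and5P[ap ad at_ pd /andP[pt /andP[dt _]]].
(* Each round takes one unit from [a], or adds one to [d] if [a] is already empty. After [y] rounds
   [d] has gained y - x and [a] holds x - y, at most one of which is nonzero. *)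
pose F i := upd (upd (upd (upd s p (unary (y - i))) a (unary (x - i))) d (unary (e + (i - x)))) t (unary i).
have {1}-> : s = F 0 by rewrite /F !subn0 sub0n addn0 !upd_id.
apply: (@runs_seq _ _ _ (F y)).
  apply: (runs_count yN) => i iy; first by rewrite /F; lookup.
  set s1 := upd (F i) p _; apply: (@runs_seq _ _ _ (upd s1 t (unary i.+1))).
    by apply: runs_inc; rewrite /s1 /F; lookup.
  apply: runs_if; have -> : upd s1 t (unary i.+1) a = unary (x - i) by rewrite /s1 /F; lookup.
  case: (leqP x i) => [xi|ix].
    have x0 : x - i = 0 by lia.
    have x1 : x - i.+1 = 0 by lia.
    have x2 : e + (i.+1 - x) = (e + (i - x)).+1 by lia.
    rewrite x0 /=; have -> : F i.+1 = upd (pop (upd s1 t (unary i.+1)) a) d (unary (e + (i - x)).+1).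
      by rewrite /s1 /F x0 x1 x2; store_eq.
    by apply: runs_inc; rewrite /s1 /F; lookup.
  have x1 : i - x = 0 by lia.
  have x2 : i.+1 - x = 0 by lia.
  rewrite -(subnSK ix) unaryS /=; have -> : F i.+1 = pop (upd s1 t (unary i.+1)) a.
    by rewrite /s1 /F -(subnSK ix) x1 x2; store_eq.
  by apply: runs_skip; rewrite /s1 /F; lookup.
pose G i := upd (upd (upd (upd s p [::]) a (unary (x - y - i))) d (unary (e + (y - x) + i))) t (unary y).
have -> : F y = G 0 by rewrite /F /G subnn subn0 addn0; store_eq.
apply: (@runs_seq _ _ _ (G (x - y))).
  apply: runs_count => [|i ixy|i ixy]; first lia.
    by rewrite /G; lookup.
  have -> : G i.+1 = upd (upd (G i) a (unary (x - y - i.+1))) d (unary (e + (y - x) + i).+1).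
    by rewrite /G addnS; store_eq.
  by apply: runs_inc; rewrite /G; lookup.
pose H i := upd (upd (upd (upd s a [::]) d (unary (e + (y - x) + (x - y)))) p (unary i)) t (unary (y - i)).
have -> : G (x - y) = H 0.
  by rewrite /G /H subnn subn0; store_eq.
have -> : upd (upd s a [::]) d (unary (e + (y - x) + (x - y))) = H y.
  by rewrite /H subnn; store_eq.
apply: (runs_count yN) => i iy; first by rewrite /H; lookup.
have -> : H i.+1 = upd (upd (H i) t (unary (y - i.+1))) p (unary i.+1) by rewrite /H; store_eq.
by apply: runs_inc; rewrite /H; lookup.
Qed.

Definition Move a b := For a (Push b false) (Push b true).

Lemma runs_move a b s l : s a = l -> size l <= N -> a != b ->
  runs (Move a b) s (upd (upd s b (catrev l (s b))) a [::]).
Proof.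
move=> sa lN ab.
pose F i := upd (upd s b (catrev (take i l) (s b))) a (drop i l).
have -> : upd (upd s b (catrev l (s b))) a [::] = F (size l).
  by rewrite /F take_size drop_size.
have {1}-> : s = F 0 by rewrite /F take0 drop0; store_eq.
apply: runs_for => // i il; first by rewrite /F; lookup.
set s1 := upd (F i) a _.
have -> : F i.+1 = upd s1 b (nth false l i :: s1 b).
  by rewrite /s1 /F (take_nth false) // -cats1 catrev_catl; store_eq.
by case: nth; apply: runs_push.
Qed.

End Runs.

(** * The election of a graph *)

Section Instance.

Variables (n k : nat) (E : seq (nat * nat)).

(** Vertex x is candidate x+1; the rivals are n+1, ..., n+k+1 and the dummies the k+1 numbers after
    them. *)
Definition ncand := n + 2 * k + 3.
Definition pvote := iota 0 ncand.
Definition qvote := iota n.+1 (2 * k.+1) ++ iota 0 n.+1.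
Definition dvote := iota (n.+1 + k.+1) k.+1 ++ iota 0 (n.+1 + k.+1).
Definition vvote x := [:: x.+1, 0 & iota 1 x ++ iota x.+2 (ncand - x.+2)].
Definition evote y x :=
  [:: y.+1, x.+1, 0 & iota 1 y ++ iota y.+2 (x - y.+1) ++ iota x.+2 (ncand - x.+2)].

Definition adj x y := ((x, y) \in E) || ((y, x) \in E).
Definition pair_vote y x := if adj y x then evote y x else dvote.

(** Each vertex or pair vote is accompanied by one vote for p and one for the rivals. The first
    remaining rival thus gets at least as many points as there are vertex and pair votes, which no
    deletion can make a vertex or dummy exceed. *)
Definition vertex_votes x :=
  [:: vvote x; pvote; qvote] ++
  flatten [seq [:: pair_vote y x; pvote; qvote] | y <- iota 0 x].
(** The additional votes give the first remaining rival a lead of k + C(k,2), and p a single point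
    that turns a tie into a win. *)
Definition all_votes :=
  flatten [seq vertex_votes x | x <- iota 0 n] ++
  flatten [seq nseq x.+1 qvote | x <- iota 0 k] ++ [:: pvote].

Definition clique_dc := mkDC ncand 0 all_votes (iota 0 ncand) k.

Lemma all_votes_ind (P : seq nat -> Prop) :
  P pvote -> P qvote -> P dvote -> (forall x, x < n -> P (vvote x)) ->
  (forall x y, y < x -> x < n -> P (evote y x)) ->
  forall v, v \in all_votes -> P v.
Proof.
move=> Pp Pq Pd Pv Pe v; rewrite !mem_cat => /or3P[||].
- move=> /flatten_mapP[x]; rewrite mem_iota => /= xn; rewrite /vertex_votes mem_cat !inE -!orbA.
  case/or4P => [/eqP->|/eqP->|/eqP->|/flatten_mapP[y]] //; first exact: Pv.
  rewrite mem_iota => /= yx; rewrite !inE /pair_vote.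
  case/or3P => [/eqP->|/eqP->|/eqP->] //; case: ifP => // _; exact: Pe.
- by move=> /flatten_mapP[x _]; rewrite mem_nseq => /andP[_ /eqP->].
- by rewrite inE => /eqP->.
Qed.

Lemma is_vote_subset (v : seq nat) : size v = ncand -> {subset iota 0 ncand <= v} ->
  is_vote ncand v.
Proof.
move=> sv sub; rewrite /is_vote perm_sym.
have us : size v <= size (iota 0 ncand) by rewrite size_iota sv.
apply: uniq_perm; rewrite ?iota_uniq //.
  exact: (leq_size_uniq (iota_uniq _ _) sub us).
by have [] := uniq_min_size (iota_uniq _ _) sub us.
Qed.

Ltac is_vote_by_subset := apply: is_vote_subset;
  rewrite /= ?size_cat /= ?size_cat ?size_iota /ncand; try lia;
  move=> z; rewrite !(inE, mem_cat, mem_iota) /ncand; lia.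

Lemma qvote_is_vote : is_vote ncand qvote.
Proof. by rewrite /qvote; is_vote_by_subset. Qed.

Lemma dvote_is_vote : is_vote ncand dvote.
Proof. by rewrite /dvote; is_vote_by_subset. Qed.

Lemma vvote_is_vote x : x < n -> is_vote ncand (vvote x).
Proof. by move=> xn; rewrite /vvote; is_vote_by_subset. Qed.

Lemma evote_is_vote y x : y < x -> x < n -> is_vote ncand (evote y x).
Proof. by move=> yx xn; rewrite /evote; is_vote_by_subset. Qed.

Lemma all_votes_is_vote v : v \in all_votes -> is_vote ncand v.
Proof.
move: v; apply: all_votes_ind => [|||x|x y]; first exact: perm_refl.
- exact: qvote_is_vote.
- exact: dvote_is_vote.
- exact: vvote_is_vote.
- exact: evote_is_vote.
Qed.

(** * Three-peakedness of the votes *)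

Lemma single_peaked_self b : single_peaked b b.
Proof. by move=> x y z _ _ _; rewrite /between /prefers; lia. Qed.

Lemma k_peaked_increasing v bs : flatten bs = iota 0 ncand ->
  all (fun b => b != [::]) bs -> size bs <= 3 ->
  (forall b, b \in bs -> restrict v b = b) -> k_peaked 3 v (iota 0 ncand).
Proof.
move=> fl ne s3 H; exists bs; split=> // b bbs; rewrite H //; exact: single_peaked_self.
Qed.

Lemma restrict_none s b : (forall x, x \in s -> x \notin b) -> restrict s b = [::].
Proof.
by move=> H; rewrite /restrict (eq_in_filter (a2 := pred0)) ?filter_pred0 // => x /H/negPf.
Qed.

Lemma restrict_all s b : (forall x, x \in s -> x \in b) -> restrict s b = s.
Proof. by move=> H; apply/all_filterP/allP. Qed.

Lemma restrict_cat s1 s2 b : restrict (s1 ++ s2) b = restrict s1 b ++ restrict s2 b.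
Proof. exact: filter_cat. Qed.

Lemma restrict_cons x s b :
  restrict (x :: s) b = if x \in b then x :: restrict s b else restrict s b.
Proof. by []. Qed.

Lemma flatten_iota2 i j : flatten [:: iota 0 i; iota i j] = iota 0 (i + j).
Proof. by rewrite iotaD -[RHS]cats0 -catA. Qed.

Lemma flatten_iota3 i j l :
  flatten [:: iota 0 i; iota i j; iota (i + j) l] = iota 0 (i + j + l).
Proof. by rewrite !iotaD -[RHS]cats0 -!catA. Qed.

Ltac restrict_iota :=
  repeat match goal with
  | |- context [restrict (?s1 ++ ?s2) ?b] => rewrite (restrict_cat s1 s2 b)
  | |- context [restrict (?x :: ?s) ?b] => rewrite (restrict_cons x s b) mem_iota
  | |- context [restrict (iota ?a ?l) (iota ?i ?j)] =>
      first [ rewrite (@restrict_none (iota a l) (iota i j));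
                last by move=> ?; rewrite !mem_iota /ncand; lia
            | rewrite (@restrict_all (iota a l) (iota i j));
                last by move=> ?; rewrite !mem_iota /ncand; lia ]
  | |- context [if ?c then _ else _] =>
      first [ rewrite (_ : c = true); last by (rewrite /ncand; lia)
            | rewrite (_ : c = false); last by (rewrite /ncand; lia) ]
  end; rewrite ?cats0 ?cat0s.

(** A vote headed by one or two vertices becomes increasing on each block once the axis is cut just
    before these vertices; [qvote] and [dvote] need a cut just before the block that heads them. *)
Lemma all_votes_peaked v : v \in all_votes -> k_peaked 3 v (iota 0 ncand).
Proof.
move: v; apply: all_votes_ind => [|||x xn|x y yx xn].
- apply: (@k_peaked_increasing _ [:: iota 0 ncand]) => //=; rewrite ?cats0 //.
    by rewrite /ncand addnS.
  by move=> b; rewrite inE => /eqP->; rewrite /pvote; restrict_iota.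
- apply: (@k_peaked_increasing _ [:: iota 0 n.+1; iota n.+1 (2 * k.+1)]) => //.
    by rewrite flatten_iota2; congr iota; rewrite /ncand; lia.
  by move=> b; rewrite !inE => /orP[]/eqP->; rewrite /qvote; restrict_iota.
- apply: (@k_peaked_increasing _ [:: iota 0 (n.+1 + k.+1); iota (n.+1 + k.+1) k.+1]) => //.
    by rewrite flatten_iota2; congr iota; rewrite /ncand; lia.
  by move=> b; rewrite !inE => /orP[]/eqP->; rewrite /dvote; restrict_iota.
- apply: (@k_peaked_increasing _ [:: iota 0 x.+1; iota x.+1 (ncand - x.+1)]) => //.
  + by rewrite flatten_iota2; congr iota; rewrite /ncand; lia.
  + by rewrite /= andbT -size_eq0 size_iota /ncand; lia.
  move=> b; rewrite !inE => /orP[]/eqP->; rewrite /vvote; restrict_iota => //.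
  by rewrite (_ : ncand - x.+1 = (ncand - x.+2).+1) //; rewrite /ncand; lia.
- apply: (@k_peaked_increasing _
    [:: iota 0 y.+1; iota y.+1 (x - y); iota x.+1 (ncand - x.+1)]) => //.
  + have -> : x.+1 = y.+1 + (x - y) by lia.
    by rewrite flatten_iota3; congr iota; rewrite /ncand; lia.
  + by rewrite /= andbT -!size_eq0 !size_iota /ncand; lia.
  move=> b; rewrite !inE => /or3P[]/eqP->; rewrite /evote; restrict_iota => //.
  + by rewrite (_ : x - y = (x - y.+1).+1) //; lia.
  + by rewrite (_ : ncand - x.+1 = (ncand - x.+2).+1) //; rewrite /ncand; lia.
Qed.

Lemma clique_dc_valid : dc_valid 3 clique_dc.
Proof.
split=> /=.
- by rewrite /ncand; lia.
- by apply/allP => v; apply: all_votes_is_vote.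
- exact: perm_refl.
- exact: all_votes_peaked.
- rewrite /dc_C /dc_cands /= /ncand addnS [iota 0 _]/= [filter _ _]/= (all_filterP _).
    by rewrite size_iota; lia.
  by apply/allP => x; rewrite mem_iota; lia.
Qed.

(** * Scores after the deletion of a set of candidates *)

Section Scores.

Variable D : seq nat.
Hypotheses (D0 : 0 \notin D) (DR : size D <= k).

Let S := [seq x <- iota 0 ncand | x \notin D].

Lemma mem_remaining x : (x \in S) = (x \notin D) && (x < ncand).
Proof. by rewrite mem_filter mem_iota. Qed.

Definition top v := ohead (restrict v S).

(** By pigeonhole, at most k deletions leave a candidate in a block of more than k; the first one
    left heads the vote whatever follows. *)
Lemma top_block a l : k < l -> a + l <= ncand ->
  exists2 z, z \in iota a l & z \in S /\ forall s, top (iota a l ++ s) = Some z.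
Proof.
move=> kl al; case Er : (restrict (iota a l) S) => [|z r].
  have sub : {subset iota a l <= D}.
    move=> x xi; case: (boolP (x \in D)) => // xD.
    suff : x \in restrict (iota a l) S by rewrite Er.
    by rewrite mem_filter xi andbT mem_remaining (negPf xD); move: xi; rewrite mem_iota; lia.
  by have := uniq_leq_size (iota_uniq a l) sub; rewrite size_iota leqNgt (leq_ltn_trans DR kl).
have : z \in restrict (iota a l) S by rewrite Er mem_head.
rewrite mem_filter => /andP[zS zi]; exists z => //; split=> // s.
by rewrite /top restrict_cat Er.
Qed.

Lemma top_cons x s : x < ncand -> top (x :: s) = if x \in D then top s else Some x.
Proof. by move=> xn; rewrite /top restrict_cons mem_remaining xn andbT; case: (x \in D). Qed.

Let a x := x.+1 \in D.

(** The number of vertices and edges inside D, each edge being counted at its larger endpoint. *)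
Definition gain := \sum_(x <- iota 0 n) (a x + \sum_(y <- iota 0 x) (adj y x && a y && a x)).
(** The number of vertex and pair votes: x is charged with its own vote and with those of the pairs
    y < x. *)
Definition base := \sum_(x <- iota 0 n) x.+1.
(** This is j + C(j,2), the number of vertices and edges of a clique on j vertices. *)
Definition tri j := \sum_(x <- iota 0 j) x.+1.

Lemma top_pvote : top pvote = Some 0.
Proof. by rewrite /pvote /ncand addnS /= top_cons ?(negPf D0) /ncand //; lia. Qed.

Lemma top_vvote x : x < n -> top (vvote x) = Some (if a x then 0 else x.+1).
Proof.
by move=> xn; rewrite !top_cons /ncand ?(negPf D0) /a; try lia; case: ifP.
Qed.

Lemma top_evote y x : y < x -> x < n ->
  top (evote y x) = Some (if ~~ a y then y.+1 else if ~~ a x then x.+1 else 0).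
Proof.
by move=> yx xn; rewrite !top_cons /ncand ?(negPf D0) /a; try lia; do 2!case: ifP.
Qed.

Lemma top_dvote : exists2 z, n + k.+1 < z & top dvote = Some z.
Proof.
have [||z] := @top_block (n.+1 + k.+1) k.+1; rewrite /ncand; try lia.
by rewrite mem_iota => zi [_ H]; exists z; [lia | apply: H].
Qed.

(** The rivals precede the dummies here and cannot all be deleted, so the top is a rival; the last
    clause expresses that it is no dummy and gains nothing from non-edges. *)
Lemma top_qvote : exists2 z, z \in S /\ n < z & top qvote = Some z /\
  (n + k.+1 < z -> top dvote != Some z).
Proof.
have [||z] := @top_block n.+1 k.+1; rewrite /ncand; try lia.
rewrite mem_iota => zi [zS H]; exists z; first by split=> //; lia.
by split; [rewrite /qvote mul2n -addnn iotaD -catA H | lia].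
Qed.

Lemma count_flatten_map (T : Type) (F : T -> seq (seq nat)) (s : seq T) (P : pred (seq nat)) :
  count P (flatten [seq F x | x <- s]) = \sum_(x <- s) count P (F x).
Proof. by rewrite count_flatten sumnE -map_comp big_map. Qed.

(** The votes of vertex x include x+1 copies each of [pvote] and [qvote], hence [base] copies of
    each overall, besides the additional ones at the end. *)
Lemma score_split z : score1 S all_votes z =
  \sum_(x <- iota 0 n) ((top (vvote x) == Some z) +
     \sum_(y <- iota 0 x) (top (pair_vote y x) == Some z)) +
  (base + 1) * (top pvote == Some z) + (base + tri k) * (top qvote == Some z).
Proof.
pose P v := top v == Some z.
rewrite -[score1 _ _ _]/(count P all_votes).
rewrite -[top pvote == _]/(P pvote) -[top qvote == _]/(P qvote).
under [in RHS]eq_bigr => x _.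
  rewrite -[top _ == _]/(P (vvote x)).
  under eq_bigr => y _ do rewrite -[top _ == _]/(P (pair_vote y x)).
  over.
have V x : count P (vertex_votes x) = (P (vvote x) + \sum_(y <- iota 0 x) P (pair_vote y x)) +
    x.+1 * (P pvote + P qvote).
  rewrite /vertex_votes count_cat count_flatten_map.
  rewrite (eq_bigr (fun y => P (pair_vote y x) + (P pvote + P qvote))); last first.
    by move=> y _; rewrite /= addn0.
  by rewrite big_split /= big_const_seq count_predT size_iota iter_addn_0; lia.
have Q : \sum_(x <- iota 0 k) count P (nseq x.+1 qvote) = P qvote * tri k.
  by rewrite big_distrr; apply: eq_bigr => x _; rewrite count_nseq.
rewrite !count_cat !count_flatten_map Q (eq_bigr _ (fun x _ => V x)).
by rewrite big_split -big_distrl -/base /=; lia.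
Qed.

Lemma score_p : score1 S all_votes 0 = gain + base + 1.
Proof.
rewrite score_split top_pvote eqxx muln1.
have -> : (top qvote == Some 0) = false.
  by have [z [_ zn] [-> _]] := top_qvote; case: z zn.
rewrite muln0 addn0 addnA /gain; congr (_ + _ + _).
apply: eq_big_seq => x; rewrite mem_iota => xn; rewrite top_vvote //; congr (_ + _).
  by case: (a x).
apply: eq_big_seq => y; rewrite mem_iota => yx; rewrite /pair_vote.
case: (adj y x) => /=.
  by rewrite top_evote; [case: (a y); case: (a x)|lia..].
by have [z zn ->] := top_dvote; case: z zn.
Qed.

Lemma sum_pair_votes_le z : \sum_(x <- iota 0 n) ((top (vvote x) == Some z) +
  \sum_(y <- iota 0 x) (top (pair_vote y x) == Some z)) <= base.
Proof.
apply: leq_sum => x _; rewrite -add1n leq_add ?leq_b1 //.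
rewrite -[X in _ <= X](size_iota 0) -sum1_size; apply: leq_sum => y _; exact: leq_b1.
Qed.

Lemma score_qtop z : top qvote = Some z -> score1 S all_votes z = base + tri k.
Proof.
move=> Ez; rewrite score_split; have [z' [_ zn] [Ez' Hd]] := top_qvote.
have zz : z = z' by apply: Some_inj; rewrite -Ez -Ez'.
subst z'; clear Ez'.
rewrite Ez eqxx top_pvote; have -> : (Some 0 == Some z) = false by case: z {Ez Hd} zn.
rewrite muln0 muln1 addn0 big1_seq // => x; rewrite mem_iota => /= xn.
rewrite top_vvote // big1_seq.
  by case: (a x); rewrite (inj_eq Some_inj); case: eqP; lia.
move=> y; rewrite mem_iota => /= yx; rewrite /pair_vote; case: ifP => _.
  by rewrite top_evote //; do 2!case: (a _); rewrite (inj_eq Some_inj); case: eqP => //; lia.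
case: eqP => // Edz; have [d dn Ed] := top_dvote.
have dz : d = z by apply: Some_inj; rewrite -Ed.
by subst d; have := Hd dn; rewrite Edz eqxx.
Qed.

(** Apart from p, only the first remaining rival profits from the votes [pvote] and [qvote]; anyone
    else scores on vertex and pair votes alone, at most [base]. *)
Lemma score_other z : z != 0 -> score1 S all_votes z <= base + tri k.
Proof.
move=> z0; case: (eqVneq (top qvote) (Some z)) => [/score_qtop->//|/negPf Ez].
rewrite score_split top_pvote (inj_eq Some_inj) eq_sym (negPf z0) Ez !muln0 !addn0.
by rewrite (leq_trans (sum_pair_votes_le z)) ?leq_addr.
Qed.

Lemma unique_winner_gain : unique_winner1 S all_votes 0 <-> tri k <= gain.
Proof.
split=> [[_ H]|H].
  (* Comparison with the first remaining rival alone already forces the bound. *)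
  have [z [zS zn] [Ez _]] := top_qvote.
  by have := H z zS; rewrite score_p (score_qtop Ez); move=> /(_ ltac:(lia)); lia.
split=> [|y _ y0]; first by rewrite mem_remaining D0 /= /ncand; lia.
by rewrite score_p; have := score_other y0; lia.
Qed.

End Scores.

(** * Cliques as the sets of maximal gain *)

Lemma tri_S j : tri j.+1 = tri j + j.+1.
Proof. by rewrite /tri -addn1 iotaD big_cat big_seq1 addn1. Qed.

Lemma tri_lt i j : i < j -> tri i < tri j.
Proof.
elim: j => // j IH; rewrite ltnS leq_eqVlt tri_S => /orP[/eqP->|/IH]; lia.
Qed.

(** Induction on n: a new vertex in a set with c earlier members adds at most 1 + c, with equality
    exactly when it is adjacent to all of them. *)
Lemma gain_clique (a : pred nat) :
  \sum_(x <- iota 0 n) (a x + \sum_(y <- iota 0 x) (adj y x && a y && a x))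
    <= tri (count a (iota 0 n)) /\
  (tri (count a (iota 0 n)) <=
     \sum_(x <- iota 0 n) (a x + \sum_(y <- iota 0 x) (adj y x && a y && a x)) <->
   forall x y, y < x -> x < n -> a x -> a y -> adj y x).
Proof.
elim: n => [|j [IHle IHeq]]; first by rewrite /tri !big_nil.
have inner : \sum_(y <- iota 0 j) (adj y j && a y && a j) <= a j * count a (iota 0 j).
  rewrite -sum1_count [X in _ * X]big_mkcond big_distrr /=; apply: leq_sum => y _.
  by case: adj; case: (a y); case: (a j).
have innerE : (forall y, y < j -> a j -> a y -> adj y j) <->
    a j * count a (iota 0 j) <= \sum_(y <- iota 0 j) (adj y j && a y && a j).
  case aj : (a j); last by split=> //; rewrite mul0n.
  rewrite mul1n -sum1_count [X in X <= _]big_mkcond /=; split=> H.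
    rewrite big_seq [X in _ <= X]big_seq; apply: leq_sum => y; rewrite mem_iota => /= yj.
    by case ay : (a y) => //; rewrite H.
  (* A missing edge at [y] loses a term that counts 1 on the other side, while the remaining terms
     are dominated one by one. *)
  move=> y yj _ ay; apply: contraLR H => nadj; rewrite -ltnNge.
  have yi : y \in iota 0 j by rewrite mem_iota.
  rewrite !(big_rem y yi) /= ay (negPf nadj) /= ltnS.
  by apply: leq_sum => z _; case: adj; case: (a z).
rewrite -addn1 iotaD big_cat big_seq1 count_cat /= add0n addn0.
have step : tri (count a (iota 0 j) + a j) =
    tri (count a (iota 0 j)) + (a j + a j * count a (iota 0 j)).
  by case: (a j); rewrite ?addn0 // addn1 tri_S mul1n add1n.
rewrite step; split; first by apply: leq_add => //; rewrite leq_add2l.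
(* Both summands obey upper bounds, so equality of the sums forces equality in each. *)
split=> [H|H].
  have H1 : tri (count a (iota 0 j)) <=
     \sum_(x <- iota 0 j) (a x + \sum_(y <- iota 0 x) (adj y x && a y && a x)) by lia.
  have /innerE H2 : a j * count a (iota 0 j) <=
     \sum_(y <- iota 0 j) (adj y j && a y && a j) by lia.
  move=> x y yx; rewrite addn1 ltnS leq_eqVlt => /orP[/eqP xj|xj] ax ay.
    by subst x; apply: H2.
  by move/IHeq: H1; apply.
apply: leq_add; first by apply/IHeq => x y yx xj; apply: H; lia.
by rewrite leq_add2l; apply/innerE => y yj aj ay; apply: H => //; lia.
Qed.

(** A clique is deleted after the shift from vertices to candidates. Conversely let K be the
    vertices in D: then tri k <= gain <= tri |K| with |K| <= k, so |K| = k as [tri] is strictly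
    increasing, and the equality case makes K a clique. *)
Lemma clique_dc_correct : has_clique n k E <-> dc1_yes clique_dc.
Proof.
split.
  move=> [K [uK sK /allP Kn Kadj]].
  have DK x : (x.+1 \in map succn K) = (x \in K) by rewrite mem_map //; apply: succn_inj.
  have D0 : 0 \notin map succn K by apply/mapP => -[].
  exists (map succn K); split=> /=.
  - by rewrite map_inj_uniq //; apply: succn_inj.
  - move=> _ /mapP[x /Kn xn ->]; rewrite mem_filter mem_iota /= /ncand; lia.
  - by rewrite size_map sK.
  - apply/unique_winner_gain => //; first by rewrite size_map sK.
    have [_ [_]] := gain_clique (fun x => x.+1 \in map succn K); rewrite (_ : count _ _ = k).
      apply=> x y yx xn; rewrite !DK => xK yK; apply: Kadj => //; lia.
    rewrite (eq_count DK) -size_filter -sK; apply/perm_size/uniq_perm => //.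
      by rewrite filter_uniq ?iota_uniq.
    by move=> x; rewrite mem_filter mem_iota; case: (boolP (x \in K)) => //= /Kn.
move=> [D [uD subD sD]].
have D0 : 0 \notin D by apply/negP => /subD; rewrite mem_filter.
move=> /(unique_winner_gain D0 sD) kg.
have [le cl] := gain_clique (fun x => x.+1 \in D); set K := [seq x <- iota 0 n | x.+1 \in D].
have cK : count (fun x => x.+1 \in D) (iota 0 n) = size K by rewrite size_filter.
rewrite cK in le cl.
have Kk : size K <= k.
  apply: leq_trans sD; rewrite -(size_map succn); apply: uniq_leq_size.
    by rewrite map_inj_uniq ?filter_uniq ?iota_uniq //; apply: succn_inj.
  by move=> _ /mapP[x xK ->]; move: xK; rewrite mem_filter => /andP[].
have Ek : size K = k.
  move: Kk; rewrite leq_eqVlt => /orP[/eqP//|/tri_lt lt].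
  by have := leq_trans kg le; rewrite leqNgt lt.
exists K; split=> //.
- by rewrite filter_uniq ?iota_uniq.
- by apply/allP => x; rewrite mem_filter mem_iota => /andP[].
move: cl; rewrite Ek => -[/(_ kg) H _] x y; rewrite !mem_filter !mem_iota /=.
move=> /andP[Dx xn] /andP[Dy yn]; rewrite neq_ltn => /orP[] lt.
  exact: H.
by rewrite orbC; apply: H.
Qed.

End Instance.

(** * The program computing the election *)

(* [rE] is the edge list in the input encoding, [rEC] its length; [rM], [rN], [rK] hold m,
   n+1 and k+1.  While the pair y < x is treated, [rNC], [rX], [rY], [rD] hold n-1-x, x, y
   and x-1-y.  [rV] accumulates the encoded votes and [rW] counts them, [rC] is the candidate
   to be printed next, and [rZ] is always empty. *)
Local Notation rOut := 0 (only parsing).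
Local Notation rV := 1 (only parsing).
Local Notation rW := 2 (only parsing).
Local Notation rE := 3 (only parsing).
Local Notation rE' := 4 (only parsing).
Local Notation rA := 5 (only parsing).
Local Notation rB := 6 (only parsing).
Local Notation rDist := 7 (only parsing).
Local Notation rF := 8 (only parsing).
Local Notation rEC := 9 (only parsing).
Local Notation rEC' := 10 (only parsing).
Local Notation rM := 11 (only parsing).
Local Notation rN := 12 (only parsing).
Local Notation rK := 13 (only parsing).
Local Notation rNC := 14 (only parsing).
Local Notation rX := 15 (only parsing).
Local Notation rY := 16 (only parsing).
Local Notation rD := 17 (only parsing).
Local Notation rC := 18 (only parsing).
Local Notation rT := 19 (only parsing).
Local Notation rT' := 20 (only parsing).
Local Notation rZ := 21 (only parsing).
Local Notation rKC := 22 (only parsing).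

Local Notation "c1 ;; c2" := (Seq c1 c2) (at level 80, right associativity).

Definition Header := Write rV rM rT.
Definition Inc r := Push r false.
Definition Print := Write rV rC rT.
Definition Prints r := WriteRange rV rC r rT rT'.
Definition Reset := Clear rZ rC.
(** The vote programs move [rC] along the candidates. An [Inc rC] right after a range skips a vertex
    already printed at the head of the vote. *)
Definition Pvote := Header;; Prints rM;; Reset;; Inc rW.
Definition Qvote :=
  Header;; Add rC rN rT;; Prints rK;; Prints rK;; Reset;; Prints rN;; Reset;; Inc rW.
Definition Dvote :=
  Header;; Add rC rN rT;; Add rC rK rT;; Prints rK;; Reset;;
  Prints rN;; Prints rK;; Reset;; Inc rW.
Definition Vvote :=
  Header;; Add rC rX rT;; Inc rC;; Print;; Reset;; Print;; Inc rC;; Prints rX;;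
  Inc rC;; Prints rNC;; Prints rK;; Prints rK;; Reset;; Inc rW.
Definition Evote :=
  Header;; Add rC rY rT;; Inc rC;; Print;; Add rC rD rT;; Inc rC;; Print;; Reset;;
  Print;; Inc rC;; Prints rY;; Inc rC;; Prints rD;; Inc rC;; Prints rNC;;
  Prints rK;; Prints rK;; Reset;; Inc rW.

Definition enc_votes (vs : seq (seq nat)) := flatten (map enc_list vs).

Arguments nums : simpl never.
Arguments enc_nat : simpl never.

(** * Correctness and cost of the program *)

Section Program.

Variables (n k : nat) (E : seq (nat * nat)) (N : nat).
Let m := ncand n k.
Let input := enc_clique n k E.
Let output := enc_dc (clique_dc n k E).

(** One [N] bounds the rounds of every loop: those over candidates, over the input and over the bits
    written. *)
Hypotheses (N2 : 1 < N) (bN : size input + size output + 2 * m <= N).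

Let mN : m <= N. Proof. by move: bN; lia. Qed.

Definition edge_bits (s : seq (nat * nat)) := flatten [seq enc_nat e.1 ++ enc_nat e.2 | e <- s].

Let size_input : size input = n.+1 + (k.+1 + ((size E).+1 + size (edge_bits E))).
Proof. by rewrite /input /enc_clique !size_cat !size_rcons !size_nseq. Qed.

Let EN : size (edge_bits E) + 2 * m <= N. Proof. by move: bN size_input; lia. Qed.

Let ec := size E.

(* The stacks hold their bits top first, whence the reversal [catrev] of the encoded votes. *)
Definition regs out vs f nc x y d kc : store := st
  [:: out; catrev (enc_votes vs) [::]; unary (size vs); edge_bits E; [::]; [::]; [::]; unary 0;
      unary f;
      unary ec; [::]; unary m; unary n.+1; unary k.+1;
      unary nc; unary x; unary y; unary d; unary 0; [::]; [::]; [::]; unary kc].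

Lemma runs_eq c s s1 s2 : runs N c s s1 -> s1 = s2 -> runs N c s s2.
Proof. by move=> H <-. Qed.

Ltac side := first [reflexivity | done | (move: mN; rewrite /m /ncand; lia) | idtac].
Ltac norm := rewrite ?st_upd ?[set_nth _ _ _ _]/=.
Ltac step l := apply: (runs_seq N2); [apply: l; side | norm].
Ltac last_step l := apply: runs_eq; [apply: l; side | norm].

Lemma enc_votes_rcons vs v : size v = m ->
  catrev (enc_votes (rcons vs v)) [::] =
  catrev (flatten (map enc_nat v)) (catrev (enc_nat m) (catrev (enc_votes vs) [::])).
Proof.
move=> sv; rewrite /enc_votes map_rcons flatten_rcons /enc_list sv.
by rewrite !catrev_catl.
Qed.

Lemma regs_rcons out vs v f nc x y d kc : is_vote m v ->
  regs out (rcons vs v) f nc x y d kc = st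
  [:: out; catrev (flatten (map enc_nat v)) (catrev (enc_nat m) (catrev (enc_votes vs) [::]));
      unary (size vs).+1; edge_bits E; [::]; [::]; [::]; unary 0;
      unary f;
      unary ec; [::]; unary m; unary n.+1; unary k.+1;
      unary nc; unary x; unary y; unary d; unary 0; [::]; [::]; [::]; unary kc].
Proof.
move=> /perm_size; rewrite size_iota => sv.
by rewrite /regs enc_votes_rcons // size_rcons.
Qed.

Lemma catrev_nums a l s : catrev (flatten (map enc_nat (iota a l))) s = catrev (nums a l) s.
Proof. by []. Qed.

Lemma catrev_nums_cons a s l :
  catrev (flatten (map enc_nat (a :: s))) l = catrev (flatten (map enc_nat s)) (catrev (enc_nat a) l).
Proof. by rewrite /= catrev_catl. Qed.

Lemma catrev_nums_cat a b l : catrev (flatten (map enc_nat (a ++ b))) l =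
  catrev (flatten (map enc_nat b)) (catrev (flatten (map enc_nat a)) l).
Proof. by rewrite map_cat flatten_cat catrev_catl. Qed.

(** Folds the explicit list of stacks back into [regs], so that only the printed bits remain to be
    compared with the vote. *)
Lemma regs_emit out vs v f nc x y d kc l : is_vote m v ->
  l = catrev (flatten (map enc_nat v)) (catrev (enc_nat m) (catrev (enc_votes vs) [::])) ->
  st
  [:: out; l; unary (size vs).+1; edge_bits E; [::]; [::]; [::]; unary 0;
      unary f;
      unary ec; [::]; unary m; unary n.+1; unary k.+1;
      unary nc; unary x; unary y; unary d; unary 0; [::]; [::]; [::]; unary kc] =
  regs out (rcons vs v) f nc x y d kc.
Proof. by move=> vm ->; rewrite regs_rcons. Qed.

Ltac vote_bits := rewrite ?(catrev_nums_cat, catrev_nums) ?addn0.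

Lemma runs_pvote out vs f nc x y d kc :
  runs N Pvote (regs out vs f nc x y d kc) (regs out (rcons vs (pvote n k)) f nc x y d kc).
Proof.
rewrite /Pvote /regs; step runs_write; step runs_range; step runs_clear; last_step runs_inc.
by apply: regs_emit => //; apply: perm_refl.
Qed.

Lemma runs_qvote out vs f nc x y d kc :
  runs N Qvote (regs out vs f nc x y d kc) (regs out (rcons vs (qvote n k)) f nc x y d kc).
Proof.
rewrite /Qvote /regs; step runs_write; step runs_addn; step runs_range; step runs_range.
step runs_clear; step runs_range; step runs_clear; last_step runs_inc.
apply: regs_emit; first exact: qvote_is_vote.
by rewrite /qvote mul2n -addnn iotaD; vote_bits.
Qed.

Lemma runs_dvote out vs f nc x y d kc :
  runs N Dvote (regs out vs f nc x y d kc) (regs out (rcons vs (dvote n k)) f nc x y d kc).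
Proof.
rewrite /Dvote /regs; step runs_write; step runs_addn; step runs_addn.
rewrite addn0 (addnC k.+1); step runs_range; step runs_clear.
step runs_range; step runs_range; step runs_clear; last_step runs_inc.
apply: regs_emit; first exact: dvote_is_vote.
by rewrite /dvote (iotaD 0); vote_bits.
Qed.

Lemma runs_vvote out vs f x y d kc : x < n ->
  runs N Vvote (regs out vs f (n - x.+1) x y d kc)
    (regs out (rcons vs (vvote n k x)) f (n - x.+1) x y d kc).
Proof.
move=> xn; rewrite /Vvote /regs; step runs_write; step runs_addn; step runs_inc; step runs_write.
step runs_clear; step runs_write; step runs_inc; step runs_range; step runs_inc.
step runs_range; step runs_range; step runs_range; step runs_clear; last_step runs_inc.
apply: regs_emit; first exact: vvote_is_vote.
(* The tail is split into later vertices, rivals and dummies, whose lengths are available in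
   counters. *)
have -> : vvote n k x = [:: x.+1, 0 & iota 1 x ++ iota x.+2 (n - x.+1) ++
    iota (x.+2 + (n - x.+1)) k.+1 ++ iota (x.+2 + (n - x.+1) + k.+1) k.+1].
  rewrite /vvote -!iotaD; do 2!congr (_ :: _); congr (_ ++ iota _ _); rewrite /ncand; lia.
by rewrite 2!catrev_nums_cons; vote_bits.
Qed.

Lemma runs_evote out vs f x y kc : y < x -> x < n ->
  runs N Evote (regs out vs f (n - x.+1) x y (x - y.+1) kc)
    (regs out (rcons vs (evote n k y x)) f (n - x.+1) x y (x - y.+1) kc).
Proof.
move=> yx xn.
have e1 : x - y.+1 + y.+1 = x by lia.
have e2 : (1 + y).+1 + (x - y.+1) = x.+1 by lia.
rewrite /Evote /regs; step runs_write; step runs_addn; rewrite addn0; step runs_inc.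
step runs_write; step runs_addn; rewrite e1; step runs_inc; step runs_write; step runs_clear.
step runs_write; step runs_inc; step runs_range; step runs_inc; step runs_range; rewrite e2.
step runs_inc; step runs_range; step runs_range; step runs_range; step runs_clear.
last_step runs_inc.
apply: regs_emit; first exact: evote_is_vote.
have -> : evote n k y x = [:: y.+1, x.+1, 0 & iota 1 y ++ iota y.+2 (x - y.+1) ++
    iota x.+2 (n - x.+1) ++ iota (x.+2 + (n - x.+1)) k.+1 ++
    iota (x.+2 + (n - x.+1) + k.+1) k.+1].
  rewrite /evote -!iotaD; do 3!congr (_ :: _); do 2!congr (_ ++ _); congr iota; rewrite /ncand; lia.
by rewrite 3!catrev_nums_cons; vote_bits.
Qed.

(* Adds to [rF] the number of occurrences of the pair ([rp], [rq]) in the edge list. *)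
Definition Read_number r := While rE (Inc r;; Inc rE');; Push rE' true.
Definition Scan rp rq :=
  While rEC (Inc rEC';; Read_number rA;; Read_number rB;;
             Dist rZ rA rp rDist rT;; Dist rZ rB rq rDist rT;;
             If rDist (Inc rF) (Clear rZ rDist) (Pop rZ));;
  While rEC' (Inc rEC);; Move rE' rE.

Lemma runs_read_number s r v l : s rE = enc_nat v ++ l -> s r = [::] -> v <= N ->
  r != rE -> r != rE' ->
  runs N (Read_number r) s
    (upd (upd (upd s rE l) r (unary v)) rE' (catrev (enc_nat v) (s rE'))).
Proof.
move=> sE sr vN rE1 rE2.
pose F i := upd (upd (upd s rE (enc_nat (v - i) ++ l)) r (unary i)) rE' (unary i ++ s rE').
have {1}-> : s = F 0 by rewrite /F subn0; store_eq.
have Hf i : i < v -> F i rE = false :: (enc_nat (v - i.+1) ++ l).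
  by move=> iv; rewrite /F -(subnSK iv); lookup.
have Hv : F v rE = true :: l by rewrite /F subnn; lookup.
apply: (runs_seq N2) (runs_while N2 vN _ _ _) _ => [i iv||i iv|].
- by rewrite Hf.
- by rewrite Hv.
- rewrite /pop Hf //=; set s1 := upd (F i) rE _.
  have -> : F i.+1 = upd (upd s1 r (unary i.+1)) rE' (false :: upd s1 r (unary i.+1) rE').
    by rewrite /s1 /F; store_eq.
  by apply: (runs_seq N2 (runs_inc N2 _) (runs_push N2 _ _ _)); rewrite /s1 /F; lookup.
- have -> : pop (F v) rE = upd (F v) rE l by rewrite /pop Hv.
  by apply: runs_eq (runs_push N2 _ _ _) _; rewrite /F catrev_enc_nat; store_eq.
Qed.

Lemma size_edge_bits s : 2 * size s <= size (edge_bits s).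
Proof.
elim: s => //= e s IH; rewrite /edge_bits /= !size_cat !size_rcons -/(edge_bits s); lia.
Qed.

Lemma edge_bits_cat s t : edge_bits (s ++ t) = edge_bits s ++ edge_bits t.
Proof. by rewrite /edge_bits map_cat flatten_cat. Qed.

(** Every bit read from the edge list is saved on [rE'], and the final [Move] reverses it back into
    [rE]; the count of entries is likewise restored from [rEC']. *)
Lemma runs_scan rp rq p q out vs f nc x y d kc : x < n -> y < n ->
  (rp, rq, p, q) = (rX, rY, x, y) \/ (rp, rq, p, q) = (rY, rX, y, x) ->
  runs N (Scan rp rq) (regs out vs f nc x y d kc)
    (regs out vs (f + count_mem (p, q) E) nc x y d kc).
Proof.
move=> xn yn pq; have EN' := EN.
have nm : n < m by rewrite /m /ncand; lia.
have ecN : ec <= N by have := size_edge_bits E; rewrite -/ec; lia.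
pose F i := st
  [:: out; catrev (enc_votes vs) [::]; unary (size vs); edge_bits (drop i E);
      catrev (edge_bits (take i E)) [::]; [::]; [::]; unary 0; unary (f + count_mem (p, q) (take i E));
      unary (ec - i); unary i; unary m;
      unary n.+1; unary k.+1; unary nc; unary x; unary y; unary d; unary 0; [::]; [::]; [::]; unary kc].
have -> : regs out vs f nc x y d kc = F 0 by rewrite /F /regs drop0 take0 subn0 addn0.
apply: (runs_seq N2) (runs_count N2 ecN (F := F) _ _) _ => // [i ie|].
  rewrite /F; norm; set e := nth (0, 0) E i.
  have E1 : edge_bits (drop i E) = enc_nat e.1 ++ enc_nat e.2 ++ edge_bits (drop i.+1 E).
    by rewrite (drop_nth (0, 0) ie) /edge_bits /= -catA.
  have E2 : edge_bits (take i.+1 E) = edge_bits (take i E) ++ enc_nat e.1 ++ enc_nat e.2.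
    by rewrite (take_nth (0, 0) ie) -cats1 edge_bits_cat {2}/edge_bits /= cats0.
  have E3 : count_mem (p, q) (take i.+1 E) = count_mem (p, q) (take i E) + (e == (p, q)).
    by rewrite (take_nth (0, 0) ie) -cats1 count_cat /= addn0.
  have eN : e.1 + e.2 + 2 + size (edge_bits (take i E)) <= size (edge_bits E).
    rewrite -{2}(cat_take_drop i E) edge_bits_cat E1 !size_cat !size_rcons !size_nseq; lia.
  (* Equality of pairs is tested by the sum of the two distances; with truncated subtraction each
     distance is two terms. *)
  have EQ : (e == (p, q)) = (0 + (p - e.1) + (e.1 - p) + (q - e.2) + (e.2 - q) == 0).
    by rewrite -pair_eqE /pair_eq /=; lia.
  rewrite E1 E2 E3 EQ; step runs_inc; step runs_read_number; step runs_read_number.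
  have -> : catrev (edge_bits (take i E) ++ enc_nat e.1 ++ enc_nat e.2) [::] =
      catrev (enc_nat e.2) (catrev (enc_nat e.1) (catrev (edge_bits (take i E)) [::])).
    by rewrite !catrev_catl.
  have pN : p < n by case: pq => -[_ _ -> _].
  have qN : q < n by case: pq => -[_ _ _ ->].
  have e1N : e.1 <= N by lia.
  have e2N : e.2 <= N by lia.
  apply: (@runs_seq _ N2 _ _ _ _).
    apply: (runs_dist N2 (x := e.1) (y := p) (e := 0)); side; try lia.
      by case: pq => -[-> _ -> _].
    by case: pq => -[-> _ _ _].
  norm; apply: (@runs_seq _ N2 _ _ _ _).
    apply: (runs_dist N2 (x := e.2) (y := q)); side; try lia.
      by case: pq => -[_ -> _ ->].
    by case: pq => -[_ -> _ _].
  norm; apply: runs_if => //; rewrite [st _ 7]/= /pop; norm.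
  have DN : 0 + (p - e.1) + (e.1 - p) + (q - e.2) + (e.2 - q) <= N by lia.
  move: (_ + (e.2 - q)) DN => [|dist] DN /=.
    rewrite addnA addn1; apply: runs_eq; first by apply: runs_inc; side.
    by norm.
  rewrite !addn0; apply: runs_eq; first by apply: (runs_clear N2 (v := dist)); side; lia.
  by norm.
pose G i := st
  [:: out; catrev (enc_votes vs) [::]; unary (size vs); [::];
      catrev (edge_bits E) [::]; [::]; [::]; unary 0; unary (f + count_mem (p, q) E);
      unary i; unary (ec - i); unary m;
      unary n.+1; unary k.+1; unary nc; unary x; unary y; unary d; unary 0; [::]; [::]; [::]; unary kc].
have -> : F ec = G 0 by rewrite /F /G drop_size take_size subnn subn0.
apply: (runs_seq N2) (runs_count N2 ecN (F := G) _ _) _ => // [i ie|].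
  by rewrite /G; norm; apply: runs_eq; [apply: runs_inc; side|norm].
rewrite /G; apply: runs_eq.
  apply: (runs_move N2 (l := catrev (edge_bits E) [::])) => //.
  by rewrite catrevE cats0 size_rev; lia.
norm; rewrite /regs subnn !catrevE !cats0 revK //.
Qed.

Lemma iota_rcons i : iota 0 i.+1 = iota 0 i ++ [:: i].
Proof. by rewrite -addn1 iotaD. Qed.

Lemma nseq_rcons (T : Type) i (z : T) : nseq i.+1 z = nseq i z ++ [:: z].
Proof. by rewrite -addn1 nseqD. Qed.

(** Both orientations are counted in [rF], as adjacency ignores the order in which an edge is
    listed. *)
Definition Pair := Scan rY rX;; Scan rX rY;; If rF Dvote (Clear rZ rF;; Evote) (Pop rZ).

Lemma runs_pair out vs x y kc : y < x -> x < n ->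
  runs N Pair (regs out vs 0 (n - x.+1) x y (x - y.+1) kc)
    (regs out (rcons vs (pair_vote n k E y x)) 0 (n - x.+1) x y (x - y.+1) kc).
Proof.
move=> yx xn; have yn : y < n by lia.
apply: (runs_seq N2); first by apply: (runs_scan (p := y) (q := x)) => //; right.
apply: (runs_seq N2); first by apply: (runs_scan (p := x) (q := y)) => //; left.
have -> : pair_vote n k E y x =
    if 0 + count_mem (y, x) E + count_mem (x, y) E is 0 then dvote n k else evote n k y x.
  rewrite /pair_vote /adj -!has_pred1 !has_count.
  by move: (count _ E) (count _ E) => [|c1] [|c2].
have : 0 + count_mem (y, x) E + count_mem (x, y) E <= N.
  rewrite add0n; apply: leq_trans (leq_add (count_size _ _) (count_size _ _)) _.
  apply: leq_trans (leq_trans (leq_addr _ _) EN).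
  by have := size_edge_bits E; rewrite mul2n -addnn.
move: (_ + count_mem (x, y) E) => [|c] cN; apply: runs_if => //.
  rewrite [regs _ _ _ _ _ _ _ _ _]/= /pop; norm.
  exact: (runs_dvote out vs 0 (n - x.+1) x y (x - y.+1) kc).
rewrite [regs _ _ _ _ _ _ _ _ _]/= /pop; norm; apply: (runs_seq N2).
  by apply: (runs_clear N2 (v := c)); side; lia.
norm; exact: (@runs_evote out vs 0 x y kc yx xn).
Qed.

(** In round y the popped counter [rD] holds x-1-y, just the length that [Evote] prints between its
    two vertices. *)
Definition Inner :=
  Add rD rX rT;; While rD (Pair;; Pvote;; Qvote;; Inc rY);; Clear rZ rY.

Definition pair_votes x y := [:: pair_vote n k E y x; pvote n k; qvote n k].

Lemma runs_inner out vs x kc : x < n ->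
  runs N Inner (regs out vs 0 (n - x.+1) x 0 0 kc)
    (regs out (vs ++ flatten [seq pair_votes x y | y <- iota 0 x]) 0 (n - x.+1) x 0 0 kc).
Proof.
move=> xn; have xN : x <= N by move: mN; rewrite /m /ncand; lia.
pose F i := regs out (vs ++ flatten [seq pair_votes x y | y <- iota 0 i]) 0 (n - x.+1) x i (x - i) kc.
rewrite /Inner; apply: (runs_seq N2).
  by rewrite /regs; apply: (runs_addn N2 (v := x) (a := 0)).
have -> : upd (regs out vs 0 (n - x.+1) x 0 0 kc) rD (unary (x + 0)) = F 0.
  by rewrite /F /regs addn0 subn0 cats0; norm.
apply: (runs_seq N2) (runs_count N2 xN (F := F) _ _) _ => // [i ix|].
  rewrite /F; have -> : upd (regs out (vs ++ flatten [seq pair_votes x y | y <- iota 0 i]) 0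
     (n - x.+1) x i (x - i) kc) rD (unary (x - i.+1)) =
     regs out (vs ++ flatten [seq pair_votes x y | y <- iota 0 i]) 0 (n - x.+1) x i (x - i.+1) kc.
    by rewrite /regs; norm.
  apply: (runs_seq N2); first exact: runs_pair.
  apply: (runs_seq N2); first exact: runs_pvote.
  apply: (runs_seq N2); first exact: runs_qvote.
  apply: runs_eq; first by rewrite /regs; apply: runs_inc; side.
  rewrite iota_rcons map_cat flatten_cat /= catA -!cats1 -!catA.
  by rewrite /regs; norm.
rewrite /F /regs subnn; apply: runs_eq; first by apply: (runs_clear N2 (v := x)).
by norm.
Qed.

(** Likewise the popped counter [rNC] holds n-1-x, the number of vertices after x. *)
Definition Outer := While rNC (Vvote;; Pvote;; Qvote;; Inner;; Inc rX);; Clear rZ rX.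

Lemma runs_outer out kc :
  runs N Outer (regs out [::] 0 n 0 0 0 kc)
    (regs out (flatten [seq vertex_votes n k E x | x <- iota 0 n]) 0 0 0 0 0 kc).
Proof.
have nN : n <= N by move: mN; rewrite /m /ncand; lia.
pose F i := regs out (flatten [seq vertex_votes n k E x | x <- iota 0 i]) 0 (n - i) i 0 0 kc.
have -> : regs out [::] 0 n 0 0 0 kc = F 0 by rewrite /F subn0.
apply: (runs_seq N2) (runs_count N2 nN (F := F) _ _) _ => // [i ix|].
  rewrite /F; have -> : upd (regs out (flatten [seq vertex_votes n k E x | x <- iota 0 i]) 0
     (n - i) i 0 0 kc) rNC (unary (n - i.+1)) =
     regs out (flatten [seq vertex_votes n k E x | x <- iota 0 i]) 0 (n - i.+1) i 0 0 kc.
    by rewrite /regs; norm.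
  apply: (runs_seq N2); first exact: runs_vvote.
  apply: (runs_seq N2); first exact: runs_pvote.
  apply: (runs_seq N2); first exact: runs_qvote.
  apply: (runs_seq N2); first exact: runs_inner.
  apply: runs_eq; first by rewrite /regs; apply: runs_inc; side.
  rewrite iota_rcons map_cat flatten_cat /= cats0 -!cats1 -!catA.
  by rewrite /regs; norm.
rewrite /F /regs subnn; apply: runs_eq; first by apply: (runs_clear N2 (v := n)).
by norm.
Qed.

Definition Extra :=
  While rKC (Add rD rX rT;; Inc rD;; While rD Qvote;; Inc rX);; Clear rZ rX.

Lemma runs_extra out vs :
  runs N Extra (regs out vs 0 0 0 0 0 k)
    (regs out (vs ++ flatten [seq nseq x.+1 (qvote n k) | x <- iota 0 k]) 0 0 0 0 0 0).
Proof.
have kN : k.+1 <= N by move: mN; rewrite /m /ncand; lia.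
pose V i := vs ++ flatten [seq nseq x.+1 (qvote n k) | x <- iota 0 i].
pose F i := regs out (V i) 0 0 i 0 0 (k - i).
have -> : regs out vs 0 0 0 0 0 k = F 0 by rewrite /F /V subn0 cats0.
apply: (runs_seq N2) (runs_count N2 (ltnW kN) (F := F) _ _) _ => // [i ix|].
  rewrite /F; have -> : upd (regs out (V i) 0 0 i 0 0 (k - i)) rKC (unary (k - i.+1)) =
     regs out (V i) 0 0 i 0 0 (k - i.+1) by rewrite /regs; norm.
  apply: (runs_seq N2).
    by rewrite /regs; apply: (runs_addn N2 (v := i) (a := 0)) => //; lia.
  apply: (runs_seq N2); first by rewrite /regs; norm; apply: runs_inc; side.
  pose G j := regs out (V i ++ nseq j (qvote n k)) 0 0 i 0 (i.+1 - j) (k - i.+1).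
  rewrite -[upd _ _ _](_ : G 0 = _); last by rewrite /G subn0 cats0 /regs addn0; norm.
  have iN : i.+1 <= N by lia.
  apply: (runs_seq N2) (runs_count N2 iN (F := G) _ _) _ => // [j ji|].
    rewrite /G; have -> : upd (regs out (V i ++ nseq j (qvote n k)) 0 0 i 0 (i.+1 - j) (k - i.+1))
       rD (unary (i.+1 - j.+1)) = regs out (V i ++ nseq j (qvote n k)) 0 0 i 0 (i.+1 - j.+1) (k - i.+1).
      by rewrite /regs; norm.
    rewrite nseq_rcons catA cats1; exact: runs_qvote.
  apply: runs_eq; first by rewrite /G /regs; apply: runs_inc; side.
  rewrite /V iota_rcons map_cat flatten_cat [map _ [:: _]]/=.
  by rewrite [flatten [:: _]]/= cats0 catA /regs subnn; norm.
rewrite /F /regs subnn; apply: runs_eq; first by apply: (runs_clear N2 (v := k)) => //; lia.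
by norm.
Qed.

(** The move brings the first input bit to the top; each loop then reads one number, and the encoded
    edges stay in [rE]. *)
Definition Parse := Move rOut rE;; While rE (Inc rNC);; While rE (Inc rKC);; While rE (Inc rEC).
(** The three increments of [rM] complete m = n + 2k + 3. The output is then m, p, R and the axis,
    the lone bit [true] being the code of p = 0. *)
Definition Prelude :=
  Add rN rNC rT;; Inc rN;; Add rM rNC rT;; Add rM rKC rT;; Add rM rKC rT;;
  Inc rM;; Inc rM;; Inc rM;; Add rK rKC rT;; Inc rK;;
  Write rOut rM rT;; Push rOut true;; Write rOut rKC rT;; Write rOut rM rT;;
  WriteRange rOut rC rM rT rT';; Reset.
(** The number of votes precedes them in the output but is known only now, hence the buffer [rV];
    moving it twice keeps its order. The rest is emptied as [machine_run] demands. *)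
Definition Finish :=
  Write rOut rW rT;; Move rV rT;; Move rT rOut;; Clear rZ rW;; Clear rZ rM;; Clear rZ rN;;
  Clear rZ rK;; Clear rZ rEC;; For rE (Pop rZ) (Pop rZ).
Definition Main := Parse;; Prelude;; Outer;; Extra;; Pvote;; Finish.

Lemma runs_read r s v l : s rE = enc_nat v ++ l -> s r = [::] -> v <= N -> r != rE ->
  runs N (While rE (Inc r)) s (upd (upd s rE l) r (unary v)).
Proof.
move=> sE sr vN rE1; pose F i := upd (upd s rE (enc_nat (v - i) ++ l)) r (unary i).
have {1}-> : s = F 0 by rewrite /F subn0; store_eq.
have Hf i : i < v -> F i rE = false :: (enc_nat (v - i.+1) ++ l).
  by move=> iv; rewrite /F -(subnSK iv); lookup.
have Hv : F v rE = true :: l by rewrite /F subnn; lookup.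
apply: runs_eq (runs_while N2 vN (F := F) _ _ _) _ => [i iv||i iv|].
- by rewrite Hf.
- by rewrite Hv.
- rewrite /pop Hf //=; set s1 := upd (F i) rE _.
  have -> : F i.+1 = upd s1 r (unary i.+1) by rewrite /s1 /F; store_eq.
  by apply: (runs_inc N2); rewrite /s1 /F; lookup.
- by rewrite /pop Hv /F; store_eq.
Qed.

Lemma runs_drop r z s l : s r = l -> s z = [::] -> size l <= N -> z != r ->
  runs N (For r (Pop z) (Pop z)) s (upd s r [::]).
Proof.
move=> sr sz lN zr; pose F i := upd s r (drop i l).
have -> : upd s r [::] = F (size l) by rewrite /F drop_size.
have {1}-> : s = F 0 by rewrite /F drop0 upd_id.
apply: (runs_for N2) => // i il; first by rewrite /F; lookup.
by rewrite if_same /F upd_upd; apply: (runs_skip N2); lookup.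
Qed.

Lemma runs_main :
  runs N Main (input_store input) (upd (fun=> [::]) 0 (rev output)).
Proof.
have mE : m = n + 2 * k + 3 by [].
have szw := size_input.
have szo : size (all_votes n k E) + size (enc_votes (all_votes n k E)) <= size output.
  rewrite /output /enc_dc /clique_dc; move: (all_votes n k E) => vs.
  rewrite [dc_votes _]/= -/(enc_votes vs) !size_cat !addnA leq_add2r.
  by rewrite [size (enc_nat (size vs))]size_rcons size_nseq addnS leqW // leq_addl.
have -> : input_store input = st [:: rev input; [::]; [::]; [::]; [::]; [::]; [::]; [::]; [::]; [::];
    [::]; [::]; [::]; [::]; [::]; [::]; [::]; [::]; [::]; [::]; [::]; [::]; [::]].
  apply: functional_extensionality => z; rewrite /input_store /upd /st.
  by do 23![case: z => [|z] //]; rewrite /= nth_nil.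
rewrite /Main /Parse /Prelude.
apply: (runs_seq N2).
  apply: (runs_seq N2).
    by apply: (runs_move N2 (l := rev input)); side; rewrite size_rev; lia.
  norm; rewrite [catrev (rev input) _]catrevE revK cats0.
  apply: (runs_seq N2).
    by apply: (runs_read (v := n)); side; rewrite ?/input; lia.
  norm; apply: (runs_seq N2).
    by apply: (runs_read (v := k)); side; lia.
  norm; apply: (runs_read (v := size E)); side; lia.
norm; apply: (runs_seq N2).
  (* Counters that are still empty are restated as [unary 0], the form in which additions expect
     them. *)
  rewrite -[st _]/(st [:: [::]; [::]; [::]; edge_bits E; [::]; [::]; [::]; [::]; [::]; unary (size E);
    [::]; unary 0; unary 0; unary 0; unary n; [::]; [::]; [::]; unary 0; [::]; [::]; [::]; unary k]).
  step runs_addn; rewrite addn0; step runs_inc; step runs_addn; step runs_addn; step runs_addn.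
  step runs_inc; step runs_inc; step runs_inc; step runs_addn; rewrite !addn0; step runs_inc.
  have -> : (k + (k + n)).+3 = m by lia.
  step runs_write; step runs_push; step runs_write; step runs_write.
  step runs_range; apply: (runs_clear N2 (v := 0 + m)); side.
norm; set h := catrev (nums 0 m) _.
set vs := all_votes n k E in szo *.
rewrite -[st _]/(regs h [::] 0 n 0 0 0 k).
apply: (runs_seq N2); first exact: runs_outer.
apply: (runs_seq N2); first exact: runs_extra.
apply: (runs_seq N2); first exact: runs_pvote.
have -> : rcons (flatten [seq vertex_votes n k E x | x <- iota 0 n] ++
    flatten [seq nseq x.+1 (qvote n k) | x <- iota 0 k]) (pvote n k) = vs.
  by rewrite -cats1 -catA.
have [vsN evN] : size vs <= N /\ size (enc_votes vs) <= N by split; lia.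
have ecN : size E <= N by lia.
have ebN : size (edge_bits E) <= N by lia.
have nN : n.+1 <= N by lia.
have kN : k.+1 <= N by lia.
rewrite /regs catrevE cats0 /Finish; step runs_write.
step runs_move; first by rewrite size_rev.
rewrite [catrev (rev _) _]catrevE revK cats0.
step runs_move.
step runs_clear; step runs_clear; step runs_clear; step runs_clear; step runs_clear.
apply: runs_eq; first by apply: (runs_drop (z := rZ)); side.
norm; apply: functional_extensionality => z; rewrite /upd /st.
case: z => [|z] /=.
  by rewrite -[rev output]cats0 -catrevE /output /enc_dc /h {1}/enc_list size_iota !catrev_catl.
by do 22![case: z => [|z] //]; rewrite /= nth_nil.
Qed.

End Program.

(** * The reduction *)

Lemma size_flatten_le (T : Type) (A : eqType) (F : A -> seq T) (s : seq A) b :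
  (forall x, x \in s -> size (F x) <= b) -> size (flatten [seq F x | x <- s]) <= size s * b.
Proof.
elim: s => //= x s IH H; rewrite size_cat mulSn leq_add ?H ?mem_head // IH // => y ys.
by rewrite H // inE ys orbT.
Qed.

Lemma size_enc_nat j : size (enc_nat j) = j.+1.
Proof. by rewrite size_rcons size_nseq. Qed.

(** * Polynomial size of the election *)

Section Size.

Variables (n k : nat) (E : seq (nat * nat)).
Let m := ncand n k.

Lemma size_all_votes : size (all_votes n k E) <= 5 * m ^ 2.
Proof.
have H1 : size (flatten [seq vertex_votes n k E x | x <- iota 0 n]) <= n * (3 * n).
  rewrite -[X in _ <= X * _](size_iota 0); apply: size_flatten_le => x; rewrite mem_iota => xn.
  rewrite /vertex_votes size_cat.
  have H : size (flatten [seq [:: pair_vote n k E y x; pvote n k; qvote n k]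
      | y <- iota 0 x]) <= size (iota 0 x) * 3 by apply: size_flatten_le.
  by apply: leq_trans (leq_add (leqnn _) H) _; rewrite size_iota /=; lia.
have H2 : size (flatten [seq nseq x.+1 (qvote n k) | x <- iota 0 k]) <= k * k.
  rewrite -[X in _ <= X * _](size_iota 0); apply: size_flatten_le => x; rewrite mem_iota => /= xk.
  by rewrite /= size_nseq; lia.
rewrite /all_votes !size_cat; apply: leq_trans (leq_add H1 (leq_add H2 (leqnn _))) _.
by rewrite /m /ncand /=; nia.
Qed.

Lemma size_enc_vote v : is_vote m v -> size (enc_list v) <= m.+1 + m * m.
Proof.
move=> vm; have sv : size v = m by rewrite (perm_size vm) size_iota.
rewrite /enc_list size_cat size_enc_nat sv leq_add2l -[X in _ <= X * _]sv.
apply: size_flatten_le => x; rewrite (perm_mem vm) mem_iota size_enc_nat; lia.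
Qed.

(** Quadratically many votes of quadratic length give degree four. *)
Lemma size_enc_clique_dc : size (enc_dc (clique_dc n k E)) <= 16 * m.+1 ^ 4.
Proof.
have H1 : size (enc_list (iota 0 m)) <= m.+1 + m * m by apply: size_enc_vote; apply: perm_refl.
have H2 : size (flatten [seq enc_list v | v <- all_votes n k E]) <= 5 * m ^ 2 * (m.+1 + m * m).
  apply: leq_trans (size_flatten_le (b := m.+1 + m * m) _) _.
    by move=> v /all_votes_is_vote /size_enc_vote.
  by rewrite leq_mul2r size_all_votes orbT.
have H3 := size_all_votes.
have H3' : (size (all_votes n k E)).+1 <= (5 * m ^ 2).+1 by [].
have km : k.+1 <= m.+1 by rewrite /m /ncand; lia.
rewrite /enc_dc /clique_dc -/m; move: (all_votes n k E) H2 {H3} H3' => vs H2 H3'.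
rewrite [dc_L _]/= [dc_votes _]/= [dc_m _]/= [dc_p _]/= [dc_R _]/=.
move: (enc_list _) H1 => L H1; rewrite !size_cat !size_enc_nat.
apply: leq_trans (leq_add (leqnn m.+1) (leq_add (leqnn 1) (leq_add km (leq_add H1
  (leq_add H3' H2))))) _.
rewrite -addn1; move: (m) => j; rewrite !expnS expn0 !muln1; nia.
Qed.

End Size.

(** The factor 9 is the degree of [N] in the input length by [bound_le], the other factor the degree
    of the time in [N] by [time_bound]. *)
Definition reduction_exponent : nat := 9 * (2 * expo Main + 4).

Lemma time_bound N e s T t : 1 < N -> s <= N -> T <= N ^ e -> t <= T * (2 * (s + T) + 3) ->
  t <= N ^ (2 * e + 4).
Proof.
move=> N2 sN TN tT; apply: leq_trans tT _.
have P : 0 < N ^ e by rewrite expn_gt0; lia.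
rewrite (_ : 2 * e + 4 = e + (e + 4)); last lia.
rewrite expnD leq_mul // expnD (expnSr N 3).
have H8 : 2 ^ 3 <= N ^ 3 by rewrite leq_exp2r.
move: (N ^ 3) (N ^ e) P TN H8 => c d P TN H8; have c8 : 8 * N <= c * N by rewrite leq_mul2r H8 orbT.
(* Since d >= 1 and c N >= 16, this bounds the product d c N from below by a linear expression in d
   and c N. *)
have : (d - 1) * (c * N - 16) + 16 * d + c * N = d * (c * N) + 16 by nia.
move: (c * N) c8 => a c8; lia.
Qed.

(** With q = |w| + 1, unary coding gives m + 1 <= 2q, so the election has size at most 256 q^4. As q
    >= 4, q^9 >= 1024 q^4 leaves room for the other summands. *)
Lemma bound_le n k E (w := enc_clique n k E) :
  size w + size (enc_dc (clique_dc n k E)) + 2 * ncand n k + 2 <= (size w).+1 ^ 9.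
Proof.
have H := size_enc_clique_dc n k E.
have sw : n + k + 3 <= size w by rewrite /w /enc_clique !size_cat !size_enc_nat; lia.
have mw : (ncand n k).+1 <= 2 * (size w).+1 by rewrite /ncand; lia.
have H4 : 16 * (ncand n k).+1 ^ 4 <= 256 * (size w).+1 ^ 4.
  by rewrite (_ : 256 = 16 * 2 ^ 4) // -mulnA -expnMn leq_mul2l leq_exp2r.
have q4 : 4 <= (size w).+1 by lia.
have H9 : 4 ^ 5 * (size w).+1 ^ 4 <= (size w).+1 ^ 9.
  by rewrite (expnD _ 5 4) leq_mul2r leq_exp2r // q4 orbT.
have H1 : (size w).+1 <= (size w).+1 ^ 4 by rewrite -[X in X <= _]expn1 leq_exp2l //; lia.
have e45 : 4 ^ 5 = 1024 by [].
rewrite e45 in H9; move: (_ ^ 9) H9 => q9 H9.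
move: ((size w).+1 ^ 4) H4 H1 H9 => q4' H4 H1 H9.
move: (_ ^ 4) H H4 => m4 H H4; lia.
Qed.

(** The successor serves as both f and g: the produced parameter is k, and a polynomial time bound
    only needs f k >= 1. *)
Lemma succ_computable : exists M, tm_computes_nat M succn.
Proof.
exists (machine 0 (program (Push 0 false))) => k.
have H := exec_push 0 false (input_store (nseq k false)).
have [|||t _ Ht] := machine_run (R := 0) (out := nseq k.+1 false) _ H; last by exists t.
- by [].
- by rewrite rev_nseq /upd /input_store /upd /= rev_nseq.
- by case.
Qed.

(* 1-DC-3 is W[1]-hard with respect to the parameter R. *)
Theorem theorem5 : W1_hard enc_dc (dc_valid 3) dc1_yes dc_R.
Proof.
have [Ms HMs] := succ_computable.
exists (machine 22 (program Main)), Ms, Ms, succn, succn, reduction_exponent.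
split=> // n k E; set w := enc_clique n k E.
(* The summand 2 ensures 1 < N, on which the absorption of constants rests. *)
pose N := size w + size (enc_dc (clique_dc n k E)) + 2 * ncand n k + 2.
have N2 : 1 < N by rewrite /N; lia.
have [T TN HT] : runs N Main (input_store w) (upd (fun=> [::]) 0 (rev (enc_dc (clique_dc n k E)))).
  by apply: runs_main => //; apply: leq_addr.
have ok : regs_ok 22 (program Main) by vm_compute.
have [||t tT Ht] := machine_run (out := enc_dc (clique_dc n k E)) ok HT.
- by rewrite /upd.
- by case.
exists t, (clique_dc n k E); split.
- have tN : t <= N ^ (2 * expo Main + 4) by apply: time_bound N2 _ TN tT; rewrite /N; lia.
  apply: leq_trans tN _; rewrite /reduction_exponent expnM.
  have NB : N <= (size w).+1 ^ 9 by exact: bound_le.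
  apply: leq_trans (leq_pmull _ (ltn0Sn k)); rewrite leq_exp2r //; lia.
- exact: Ht.
- exact: clique_dc_valid.
- exact: leqnSn.
- exact: clique_dc_correct.
Qed.
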